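(* Let $(E,(P_t)_{t\ge 0},obs)$ be a CTMP and $0<c<1$. The pseudometric $\lambda^c(x,y)=\sup_{f\in\Lambda_c}|f(x)-f(y)|$ is a fixpoint of $\mathcal{F}_c$, i.e. $\mathcal{F}_c(\lambda^c)=\lambda^c$.
   Context: $E$ is a locally compact Hausdorff space with a countable base, equipped with its Borel $\sigma$-algebra; $E$ is Polish, with topology $\mathcal{O}$. A CTMP consists of: a strongly continuous semigroup $(\hat P_t)_{t\ge 0}$ of bounded linear operators on $C_0(E)$ (continuous functions vanishing at infinity, sup norm), $\hat P_0=I$, $\hat P_s\hat P_t=\hat P_{s+t}$, with $0\le f\le 1 \Rightarrow 0\le \hat P_t f\le 1$; associated Markov kernels $P_t$ with $\hat P_t f(x)=\int f(y)\,P_t(x,\mathrm{d}y)$, honest ($P_t(x,E)=1$; write $P_t(x)=P_t(x,\cdot)$); a continuous $obs:E\to[0,1]$; and $x_n\to x$ implies $P_t(x_n)\to P_t(x)$ weakly for every $t$. $W(m)(\mu,\nu)=\inf_{\gamma\in\Gamma(\mu,\nu)}\int m\,\mathrm{d}\gamma$ over couplings $\Gamma(\mu,\nu)$, for lower semicontinuous $m$; $\mathcal{F}_c(m)(x,y)=\sup_{t\ge0}c^tW(m)(P_t(x),P_t(y))$ for lower semicontinuous 1-bounded pseudometrics $m$. The logic $\Lambda$ is generated by $f::= q \mid obs \mid \min\{f_1,f_2\}\mid 1-f\mid f\ominus q\mid \langle t\rangle f$ with $q\in[0,1]\cap\mathbb{Q}$, $t\in\mathbb{Q}_{\ge0}$;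 $\Lambda_c$ is its interpretation as functions $E\to[0,1]$: $q(x)=q$, $obs(x)=obs(x)$, $\min\{f_1,f_2\}(x)=\min\{f_1(x),f_2(x)\}$, $(1-f)(x)=1-f(x)$, $(f\ominus q)(x)=\max\{0,f(x)-q\}$, $(\langle t\rangle f)(x)=c^t\int f(y)\,P_t(x,\mathrm{d}y)$. *)

(* Defs.v *)
From HB Require Import structures.
From mathcomp Require Import all_boot all_order all_algebra.
From mathcomp Require Import all_classical all_reals all_analysis.

Set Implicit Arguments.
Unset Strict Implicit.
Unset Printing Implicit Defensive.

Import Order.TTheory GRing.Theory Num.Theory.
Import numFieldNormedType.Exports.

Local Open Scope classical_set_scope.
Local Open Scope ring_scope.

(* Measurable types are pointed, hence [ptopologicalType]. *)
Definition borel (E : ptopologicalType) : measurableType (@open E).-sigma :=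
  g_sigma_algebraType (@open E).

Definition is_metric (R : realType) (T : Type) (d : T -> T -> R) :=
  [/\ forall x y, 0 <= d x y,
      forall x y, d x y = 0 <-> x = y,
      forall x y, d x y = d y x &
      forall x y z, d x z <= d x y + d y z].

Definition induces_topology (R : realType) (T : topologicalType)
    (d : T -> T -> R) :=
  forall (x : T) (U : set T),
    nbhs x U <-> exists2 e : R, 0 < e & [set y | d x y < e] `<=` U.

Definition complete_for (R : realType) (T : topologicalType)
    (d : T -> T -> R) :=
  forall u : nat -> T,
    (forall e : R, 0 < e -> exists N : nat,
      forall m n : nat, (N <= m)%N -> (N <= n)%N -> d (u m) (u n) < e) ->
    exists x : T, u @ \oo --> x.

Definition polish_space (R : realType) (T : topologicalType) :=
  (exists2 D : set T, countable D & dense D) /\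
  (exists d : T -> T -> R,
    [/\ is_metric d, induces_topology d & complete_for d]).

Section C0.
Variables (R : realType) (E : topologicalType).

Definition vanishes_at_infinity (f : E -> R) :=
  forall e : R, 0 < e ->
    exists2 K : set E, compact K & forall x, ~ K x -> `|f x| < e.

Definition C0_pred : {pred E -> R} :=
  [pred f | `[< continuous f /\ vanishes_at_infinity f >] ].

Record C0 := MkC0 { C0_fun :> E -> R ; C0_funP : C0_fun \in C0_pred }.

HB.instance Definition _ := [isSub for C0_fun].
HB.instance Definition _ := [Choice of C0 by <:].

Lemma C0_submod_closed : submod_closed C0_pred.
Proof.
split=> [|a f g].
  apply/asboolP; split; first exact: cst_continuous.
  move=> e e0; exists set0; first exact: compact0.
  by move=> x _; rewrite normr0.
move=> /asboolP[cf vf] /asboolP[cg vg]; apply/asboolP; split.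
  move=> x; apply: (@continuousD _ _ _ (a *: f) g); last exact: cg.
  by apply: (@continuousZl_tmp _ _ _ f a); exact: cf.
move=> e e0; have a0 : 0 < `|a| + 1 by rewrite ltr_wpDl.
have [K cK fK] := vf (e / 2 / (`|a| + 1))
  (divr_gt0 (divr_gt0 e0 (ltr0n _ 2)) a0).
have [L cL gL] := vg (e / 2) (divr_gt0 e0 (ltr0n _ 2)).
exists (K `|` L); first exact: compactU.
move=> x /not_orP[Kx Lx].
apply: le_lt_trans (ler_normD _ _) _; rewrite [ltRHS]splitr.
apply: ler_ltD; last exact: gL.
rewrite normrM (le_trans (ler_wpM2l _ (ltW (fK x Kx))))//.
rewrite mulrCA ler_piMr ?divr_ge0 ?ltW//.
by rewrite ltr_pdivrMr// mul1r ltrDl.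
Qed.

HB.instance Definition _ := GRing.isSubmodClosed.Build _ _ C0_pred
  C0_submod_closed.
HB.instance Definition _ := [SubChoice_isSubLmodule of C0 by <:].

Definition C0_norm (f : C0) : R := sup [set `|f x| | x in [set: E]].

End C0.

Section weak_convergence.
Variables (R : realType) (E : ptopologicalType).
Implicit Types mu : {measure set (borel E) -> \bar R}.

Definition cvg_weakly (mu_ : nat -> {measure set (borel E) -> \bar R}) mu :=
  forall g : E -> R, continuous g -> (exists M, forall x, `|g x| <= M) ->
    (\int[mu_ n]_y g y) @[n --> \oo] --> \int[mu]_y g y.

End weak_convergence.

Record CTMP (R : realType) (E : ptopologicalType) := MkCTMP {
  semigroup : {nonneg R} -> {linear C0 R E -> C0 R E} ;
  semigroup_bounded : forall t, exists M : R,
    forall f, C0_norm (semigroup t f) <= M * C0_norm f ;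
  semigroup_0 : forall f, semigroup 0%:nng f = f ;
  semigroup_D : forall s t f,
    semigroup s (semigroup t f) = semigroup (s%:num + t%:num)%:nng f ;
  semigroup_strongly_continuous : forall (f : C0 R E) (e : R), 0 < e ->
    exists2 d : R, 0 < d & forall t : {nonneg R}, t%:num < d ->
      C0_norm (semigroup t f - f) < e ;
  semigroup_unit_interval : forall t (f : C0 R E),
    (forall x, 0 <= f x <= 1) -> forall x, 0 <= semigroup t f x <= 1 ;
  kernel_at : {nonneg R} -> R.-pker (borel E) ~> (borel E) ;
  semigroup_kernel : forall t (f : C0 R E) (x : E),
    semigroup t f x = \int[kernel_at t x]_y f y ;
  kernel_at_weak_continuous : forall t (u : nat -> E) (x : E), u @ \oo --> x ->
    cvg_weakly (fun n => kernel_at t (u n)) (kernel_at t x) ;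
  obs : E -> R ;
  obs_continuous : continuous obs ;
  obs_unit_interval : forall x, 0 <= obs x <= 1
}.

Section wasserstein.
Variables (R : realType) (E : ptopologicalType).
Implicit Types mu nu : {measure set (borel E) -> \bar R}.

(* [E * E] carries the product sigma-algebra, which is its Borel          *)
(* sigma-algebra since [E] is second countable.                           *)
Definition coupling mu nu
    (gamma : probability (borel E * borel E)%type R) :=
  forall A : set (borel E), measurable A ->
    gamma (A `*` setT) = mu A /\ gamma (setT `*` A) = nu A.

Definition W (m : E -> E -> R) mu nu : \bar R :=
  ereal_inf [set (\int[gamma]_z (m z.1 z.2)%:E)%E |
              gamma in [set gamma | coupling mu nu gamma]].

Definition lsc (m : E -> E -> R) :=
  lower_semicontinuous (fun z : E * E => (m z.1 z.2)%:E).

Definition pseudometric1 (m : E -> E -> R) :=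
  [/\ forall x y, 0 <= m x y <= 1,
      forall x, m x x = 0,
      forall x y, m x y = m y x &
      forall x y z, m x z <= m x y + m y z].

End wasserstein.

Inductive formula :=
| FConst of {i01 rat}
| FObs
| FMin of formula & formula
| FNeg of formula
| FSub of formula & {i01 rat}
| FDia of {nonneg rat} & formula.

Section functional_and_logic.
Variables (R : realType) (E : ptopologicalType) (X : CTMP R E) (c : R).

(* Values in [\bar R], so that no default value of a real [inf]/[sup] can *)
(* interfere.                                                             *)
Definition Fc (m : E -> E -> R) (x y : E) : \bar R :=
  ereal_sup [set ((c `^ t%:num)%:E *
                 W m (kernel_at X t x) (kernel_at X t y))%E |
              t in [set: {nonneg R}]].

Definition time_of_rat (t : {nonneg rat}) : {nonneg R} :=
  NngNum (etrans (ler0q R t%:num) (ge0 t)).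

Fixpoint interp (f : formula) : E -> R :=
  match f with
  | FConst q => fun=> ratr q%:num
  | FObs => obs X
  | FMin f1 f2 => fun x => Num.min (interp f1 x) (interp f2 x)
  | FNeg f => fun x => 1 - interp f x
  | FSub f q => fun x => Num.max 0 (interp f x - ratr q%:num)
  | FDia t f => fun x =>
      c `^ (ratr t%:num) * \int[kernel_at X (time_of_rat t) x]_y interp f y
  end.

Definition Lambda : set (E -> R) := range interp.

Definition lambda (x y : E) : R := sup [set `|f x - f y| | f in Lambda].

End functional_and_logic.

(* Main.v *)
Require Import Defs.
From HB Require Import structures.
From mathcomp Require Import all_boot all_order all_algebra finmap.
From mathcomp Require Import all_classical all_reals all_analysis.
From mathcomp Require Import measurable_realfun ring lra.

Set Implicit Arguments.
Unset Strict Implicit.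
Unset Printing Implicit Defensive.

Import Order.TTheory GRing.Theory Num.Theory.
Import numFieldNormedType.Exports.
Local Open Scope classical_set_scope.
Local Open Scope ring_scope.

(** For [>=] only time [0] is needed: [P_0 x] gives mass [1] to every open
    neighbourhood of [x], so every coupling of [P_0 x] and [P_0 y] is
    concentrated near [(x, y)], where [lambda] is at least about
    [|f x - f y|].

    For [<=] put [mu = P_t x], [nu = P_t y] and [L = c^-t lambda(x, y)].  Every
    formula [f] satisfies [int f dmu - int f dnu <= L]: for rational [t] this is
    the formula [<t> f], and [s |-> int f dP_s x] is right continuous by strong
    continuity of the semigroup and tightness.  Enumerate the formulas and let
    [D_n] be the pseudometric given by the first [n] of them, so that [D_n]
    increases to [lambda].  Cutting [E] into finitely many Borel cells of small
    [D_n]-diameter reduces the transport problem for [D_n] to a finite linear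
    program; by Farkas' lemma its value is a supremum over [D_n]-Lipschitz
    functions on the cells, and the lattice operations of the logic
    approximate these by formulas (as in the Stone-Weierstrass theorem).  Hence
    there are couplings [gamma_n] with [int D_n dgamma_n <= L + 1/(n+1)].  An
    ultrafilter limit of the [gamma_n] on measurable rectangles is a content with
    tight marginals, so it extends to a coupling [gamma]; it satisfies
    [int D_n dgamma <= L] for all [n], and monotone convergence gives
    [int lambda dgamma <= L]. *)

(** * Farkas' lemma and finite transport *)

(* Bartl's induction on the number of functionals. *)
Lemma farkas (R : realFieldType) (V : lmodType R) (I : eqType) (s : seq I)
    (al : I -> V -> R) (ga : V -> R) :
  uniq s -> (forall i, scalar (al i)) -> scalar ga ->
  (forall v, (forall i, i \in s -> al i v <= 0) -> ga v <= 0) ->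
  exists2 u : I -> R, (forall i, 0 <= u i) &
    forall v, ga v = \sum_(i <- s) u i * al i v.
Proof.
elim: s al ga => [|i0 s IH] al ga.
  move=> _ _ lga ga0; exists (fun=> 0) => // v; rewrite big_nil; apply/eqP.
  rewrite eq_le ga0//=; have := ga0 (-1 *: v + 0) (fun _ => ltac:(by [])).
  have ga00 : ga 0 = 0.
    by have := lga (-1) 0 0; rewrite scaler0 addr0 mulN1r addNr.
  by rewrite lga ga00 addr0 mulN1r oppr_le0.
move=> /= /andP[i0s us] lal lga ga0.
(* Either [i0] can get weight 0, or some [x] satisfies the constraints of [s] with [ga x > 0]; the
   full hypothesis then forces [al i0 x > 0]. *)
have [H|] := pselect (forall v, (forall i, i \in s -> al i v <= 0) -> ga v <= 0).
  have [u u0 uE] := IH _ _ us lal lga H.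
  exists (fun i => if i == i0 then 0 else u i) => [i|v]; first by case: ifP.
  rewrite big_cons eqxx mul0r add0r uE; apply: eq_big_seq => i iin.
  by rewrite /= ifN//; apply: contraNneq i0s => <-.
move=> /existsNP[x /not_implyP[xs /negP]]; rewrite -ltNge => gx.
have ax : 0 < al i0 x.
  rewrite ltNge; apply/negP => ax; move: gx; rewrite ltNge => /negP; apply.
  by apply: ga0 => i; rewrite inE => /orP[/eqP->//|]; exact: xs.
have f0 (f : V -> R) : scalar f -> f 0 = 0.
  by move=> lf; have := lf (-1) 0 0; rewrite scaler0 addr0 mulN1r addNr.
have fZ (f : V -> R) : scalar f -> forall a v, f (a *: v) = a * f v.
  by move=> lf a v; rewrite -[a *: v]addr0 lf f0// addr0.
(* [p f] is [f] composed with the projection along [x] onto the kernel of [al i0]. It kills [al i0],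
   so the induction hypothesis applies to the projected functionals. *)
pose p (f : V -> R) := fun v => f v - f x / al i0 x * al i0 v.
have lp f : scalar f -> scalar (p f).
  by move=> lf a u v; rewrite /p lf lal; ring.
have pE f v : scalar f -> p f v = f ((- (al i0 v / al i0 x)) *: x + v).
  by move=> lf; rewrite lf /p; field; rewrite gt_eqF.
have [||v H|u u0 uE] := IH (fun i => p (al i)) (p ga) us.
- by move=> i; exact: lp.
- exact: lp.
- rewrite pE//; apply: ga0 => i; rewrite inE => /orP[/eqP->|/H].
    by rewrite -pE// /p divff ?gt_eqF// mul1r subrr.
  by rewrite pE.
(* The weight of [i0] is what undoing the projection leaves over. It is nonnegative because
   [ga x > 0] while every [u j * al j x <= 0]. *)
exists (fun i => if i == i0 then
    (ga x - \sum_(j <- s) u j * al j x) / al i0 x else u i) => [i|v].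
  case: ifP => // _; rewrite divr_ge0// ?(ltW ax)// subr_ge0.
  rewrite (le_trans _ (ltW gx))// big_seq sumr_le0// => j js.
  by rewrite mulr_ge0_le0// xs.
rewrite big_cons eqxx.
rewrite [X in _ = _ + X](eq_big_seq (fun i => u i * al i v)); last first.
  by move=> i iin; rewrite /= ifN//; apply: contraNneq i0s => <-.
have := uE v; rewrite /p => /eqP; rewrite subr_eq => /eqP ->.
have -> : \sum_(i <- s) u i * (al i v - al i x / al i0 x * al i0 v) =
    \sum_(i <- s) u i * al i v -
    (\sum_(i <- s) u i * al i x) / al i0 x * al i0 v.
  by rewrite !mulr_suml -sumrB; apply: eq_bigr => i _; ring.
ring.
Qed.

(** Linear programming duality through Farkas' lemma: the multipliers of the constraints
    [g i + h j <= s * d i j] form the transport plan. The triangle inequality allows the two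
    potentials [g] and [h] to be replaced by a single Lipschitz function. *)
Lemma finite_kantorovich (R : realFieldType) (I : finType) (d : I -> I -> R)
    (mu nu : I -> R) (L : R) :
  (forall i, d i i = 0) -> (forall i j, d i j = d j i) ->
  (forall i j k, d i k <= d i j + d j k) ->
  (forall i, 0 <= mu i) -> (forall i, 0 <= nu i) ->
  \sum_i mu i = \sum_i nu i ->
  (forall k : I -> R, (forall i j, k i - k j <= d i j) ->
    \sum_i k i * (mu i - nu i) <= L) ->
  exists pi : I -> I -> R, [/\ forall i j, 0 <= pi i j,
    forall i, \sum_j pi i j = mu i,
    forall j, \sum_i pi i j = nu j &
    \sum_i \sum_j pi i j * d i j <= L].
Proof.
move=> d0 dC dT mu0 nu0 munu HL.
(* A vector holds the dual potentials [g] (at [inl]), [h] (at [inr]) and, at [None], a scale [s]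
   that makes the dual program homogeneous. *)
pose V := {ffun option (I + I) -> R^o}.
pose al (p : option (I * I)) (v : V) : R :=
  if p is Some (i, j) then
    v (Some (inl i)) + v (Some (inr j)) - v None * d i j
  else - v None.
pose ga (v : V) : R := \sum_i v (Some (inl i)) * mu i +
  \sum_i v (Some (inr i)) * nu i - v None * L.
have lal p : scalar (al p).
  by move=> a u v; case: p => [[i j]|]; rewrite /al !ffunE /GRing.scale /=; ring.
have lga : scalar ga.
  move=> a u v; rewrite /ga !ffunE /GRing.scale /=.
  under eq_bigr do rewrite !ffunE /GRing.scale /= mulrDl -mulrA.
  under [X in _ + X - _]eq_bigr do rewrite !ffunE /GRing.scale /= mulrDl -mulrA.
  by rewrite !big_split /= -!mulr_sumr; ring.
have [v Hv|u u0 uE] := farkas (index_enum_uniq _) lal lga.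
  have {}Hv p : al p v <= 0 by apply: Hv; exact: mem_index_enum.
  set s := v None; set g := fun i => v (Some (inl i)).
  set h := fun i => v (Some (inr i)).
  have s0 : 0 <= s by have := Hv None; rewrite /al oppr_le0.
  have gh i j : g i + h j <= s * d i j.
    by have := Hv (Some (i, j)); rewrite /al subr_le0.
  pose am i := [arg min_(j < i) (s * d i j - h j)]%O.
  pose k i := s * d i (am i) - h (am i).
  have kle i j : k i <= s * d i j - h j.
    by rewrite /k /am; case: arg_minP => // i1 _; exact.
  have kL i j : k i - k j <= s * d i j.
    rewrite lerBlDr (le_trans (kle i (am j)))// /k addrA lerB//.
    by rewrite -mulrDr ler_wpM2l.
  have gk i : g i <= k i by rewrite /k lerBrDr gh.
  have hk i : h i <= - k i.
    by rewrite lerNr; have := kle i i; rewrite d0 mulr0 add0r.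
  have E : ga v <= \sum_i k i * (mu i - nu i) - s * L.
    rewrite /ga lerB// -big_split/=; apply: ler_sum => i _.
    rewrite mulrBr -mulNr; apply: lerD; apply: ler_wpM2r => //.
      exact: gk.
    exact: hk.
  apply: (le_trans E); rewrite subr_le0.
  (* At [s = 0] the function [k] cannot be rescaled, but it is then constant and the equal total
     masses cancel. *)
  have [s00|sn0] := eqVneq s 0.
    rewrite s00 mul0r; have kc i j : k i = k j.
      apply/eqP; rewrite eq_le.
      by have := kL i j; have := kL j i; rewrite s00 !mul0r !subr_le0 => -> ->.
    have [i0 _|I0] := pickP (mem I); last by rewrite big_pred0.
    under eq_bigr do rewrite (kc _ i0).
    by rewrite -mulr_sumr sumrB munu subrr mulr0.
  have sp : 0 < s by rewrite lt_neqAle eq_sym sn0.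
  have := HL (fun i => k i / s); rewrite -ler_pdivrMl// => H.
  rewrite mulrC mulr_suml; under eq_bigr do rewrite mulrAC.
  by apply: H => i j; rewrite -mulrBl ler_pdivrMr// mulrC.
(* Evaluating the Farkas identity at basis vectors reads off the rows, the columns and, at [None],
   the cost: it equals [L] minus the multiplier of [0 <= s]. *)
pose dl (x : option (I + I)) : V := [ffun y => (y == x)%:R].
have sumE (f : option (I * I) -> R) :
    \sum_p f p = f None + \sum_i \sum_j f (Some (i, j)).
  rewrite (bigD1 None)//=; congr +%R.
  rewrite pair_big_dep/= (reindex_omap Some id); last by case.
  by apply: eq_big => [[i j]|[i j] _]//=; rewrite eqxx.
pose pi i j := u (Some (i, j)).
exists pi; split => [i j|i|j|]; first exact: u0.
- have := uE (dl (Some (inl i))); rewrite /ga !ffunE/=.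
  rewrite (bigD1 i)//= !ffunE eqxx mul1r big1 ?addr0; last first.
    by move=> j ji; rewrite !ffunE (inj_eq Some_inj) (inj_eq inl_inj) (negbTE ji) mul0r.
  rewrite big1 ?mul0r ?subr0 ?addr0; last by move=> j _; rewrite !ffunE mul0r.
  move=> ->; rewrite sumE/= !ffunE/= oppr0 mulr0 add0r.
  rewrite [RHS](bigD1 i)//= [X in _ = _ + X]big1 ?addr0; last first.
    move=> j ji; rewrite big1// => j' _; rewrite !ffunE/=.
    by rewrite (inj_eq Some_inj) (inj_eq inl_inj) (negbTE ji) mul0r addr0 subrr mulr0.
  apply: eq_bigr => j _; rewrite !ffunE/= eqxx mul0r addr0 subr0 mulr1//.
- have := uE (dl (Some (inr j))); rewrite /ga !ffunE/=.
  rewrite big1; last by move=> i _; rewrite !ffunE mul0r.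
  rewrite (bigD1 j)//= !ffunE eqxx mul1r big1 ?addr0; last first.
    by move=> i ji; rewrite !ffunE (inj_eq Some_inj) (inj_eq inr_inj) (negbTE ji) mul0r.
  rewrite mul0r subr0 add0r.
  move=> ->; rewrite sumE/= !ffunE/= oppr0 mulr0 add0r.
  apply: eq_bigr => i _; rewrite [RHS](bigD1 j)//= [X in _ = _ + X]big1 ?addr0; last first.
    move=> j' ji; rewrite !ffunE/=.
    by rewrite (inj_eq Some_inj) (inj_eq inr_inj) (negbTE ji) mul0r addr0 subrr mulr0.
  by rewrite !ffunE/= eqxx mul0r add0r subr0 mulr1.
- have := uE (dl None); rewrite /ga !ffunE/=.
  rewrite big1; last by move=> i _; rewrite !ffunE mul0r.
  rewrite big1; last by move=> i _; rewrite !ffunE mul0r.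
  rewrite mul1r !add0r sumE.
  have -> : \sum_i \sum_j u (Some (i, j)) * al (Some (i, j)) (dl None) =
      - \sum_i \sum_j pi i j * d i j.
    rewrite -sumrN; apply: eq_bigr => i _; rewrite -sumrN; apply: eq_bigr => j _.
    by rewrite /al !ffunE/= mul1r !add0r mulrN.
  rewrite /= !ffunE/= mulrN1 => /eqP; rewrite -opprD eqr_opp => /eqP ->.
  by rewrite lerDr.
Qed.

(** * Locally compact metrizable spaces *)

Lemma cvgr_sum (R : realType) (T I : Type) (F : set_system T) (s : seq I)
    (f : I -> T -> R) (l : I -> R) : Filter F ->
  (forall i, f i x @[x --> F] --> l i) ->
  \sum_(i <- s) f i x @[x --> F] --> \sum_(i <- s) l i.
Proof.
move=> FF fl; elim: s => [|i s IH].
  by under eq_fun do rewrite big_nil; rewrite big_nil; exact: cvg_cst.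
by under eq_fun do rewrite big_cons; rewrite big_cons; exact: cvgD.
Qed.

Section metrizable.
Context {R : realType} {E : ptopologicalType} {d : E -> E -> R}.
Hypotheses (d_metric : is_metric d) (d_topology : induces_topology d).

Let d_ge0 x y : 0 <= d x y. Proof. by have [] := d_metric. Qed.
Let dxx x : d x x = 0. Proof. by have [_ /(_ x x)[_ ->]] := d_metric. Qed.
Let dC x y : d x y = d y x. Proof. by have [] := d_metric. Qed.
Let dT x y z : d x z <= d x y + d y z. Proof. by have [] := d_metric. Qed.

Lemma metric_dist_continuous p : continuous (d p).
Proof.
move=> x; apply/cvgrPdist_lt => e e0; apply/d_topology; exists e => //= y.
move=> /= xy; apply: le_lt_trans xy.
have := dT p y x; have := dT p x y; rewrite (dC y x) ler_norml => ? ?.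
by apply/andP; split; lra.
Qed.

Definition metric_bump (p : E) (e : R) (x : E) := Num.max 0 (1 - d p x / e).

Lemma metric_bump_continuous p e : continuous (metric_bump p e).
Proof.
move=> x; apply: (@continuous_max _ _ (fun=> 0) (fun x => 1 - d p x / e)).
  exact: cst_continuous.
apply: cvgB; first exact: cvg_cst.
by apply: cvgM; [exact: metric_dist_continuous|exact: cvg_cst].
Qed.

Lemma metric_bump_ge0 p e x : 0 <= metric_bump p e x.
Proof. by rewrite /metric_bump le_max lexx. Qed.

Lemma metric_bump_le1 p e x : 0 < e -> metric_bump p e x <= 1.
Proof.
by move=> e0; rewrite /metric_bump ge_max ler01/= gerBl divr_ge0// ltW.
Qed.

Lemma metric_bump_center p e : metric_bump p e p = 1.
Proof. by rewrite /metric_bump dxx mul0r subr0; apply/max_idPr. Qed.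

Lemma metric_bump_eq0 p e x : 0 < e -> e <= d p x -> metric_bump p e x = 0.
Proof.
move=> e0 ed; apply/max_idPl; rewrite subr_le0 ler_pdivlMr//.
by rewrite mul1r.
Qed.

Lemma metrizable_sequential_continuous (g : E -> R) :
  (forall (u : nat -> E) x, u @ \oo --> x -> g (u n) @[n --> \oo] --> g x) ->
  continuous g.
Proof.
move=> H x; apply/cvgrPdist_lt => e e0; apply/d_topology.
apply: contrapT => /forall2NP ne.
have /choice[u hu] (n : nat) :
    exists y, d x y < n.+1%:R^-1 /\ ~ `|g x - g y| < e.
  have [/negP|] := ne n.+1%:R^-1; first by rewrite invr_gt0 ltr0n.
  by move=> /existsNP[y /not_implyP[? ?]]; exists y.
have ux : u @ \oo --> x.
  move=> A /d_topology[r r0 rA].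
  have [N Nr] : exists N : nat, N.+1%:R^-1 < r.
    exists (Num.bound r^-1); rewrite invf_plt ?posrE//.
    by rewrite (lt_trans (archi_boundP _))// ?invr_ge0 ?ltW// ltr_nat.
  exists N => // n /= Nn; apply: rA => /=.
  apply: (lt_trans (hu n).1); apply: le_lt_trans Nr.
  by rewrite lef_pV2 ?posrE// ler_nat.
have /cvgrPdist_lt/(_ e e0)[N _ /(_ N (leqnn _))] := H u x ux.
exact: (hu N).2.
Qed.

Hypothesis E_locally_compact : locally_compact [set: E].

Lemma locally_compact_ball p : exists e, 0 < e /\
  exists2 K, compact K & [set x | d p x < e] `<=` K.
Proof.
have [K + [cK _]] := @E_locally_compact p I; rewrite /within/= => pK.
have /d_topology[e e0 eK] := pK.
by exists e; split => //; exists K => // x /eK; exact.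
Qed.

Lemma C0_of_compact_support (f : E -> R) (K : set E) : continuous f ->
  compact K -> (forall x, ~ K x -> f x = 0) -> f \in @C0_pred R E.
Proof.
move=> cf cK f0; apply/asboolP; split => // e e0; exists K => // x Kx.
by rewrite f0// normr0.
Qed.

(** The tent of radius [Num.min e r] is supported both in a compact ball, hence lies in [C0], and in
    [U]. *)
Lemma open_nbhs_bump p U : open U -> U p ->
  exists f : C0 R E, [/\ forall x, 0 <= f x <= 1, f p = 1 &
    forall x, ~ U x -> f x = 0].
Proof.
move=> oU Up.
have /d_topology[r r0 rU] : nbhs p U by exact: open_nbhs_nbhs.
have [e [e0 [K cK eK]]] := locally_compact_ball p.
have m0 : 0 < Num.min e r by rewrite lt_min e0.
have bC0 : metric_bump p (Num.min e r) \in @C0_pred R E.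
  apply: (@C0_of_compact_support _ K) => //.
    exact: metric_bump_continuous.
  move=> x Kx; apply: metric_bump_eq0 => //; rewrite leNgt; apply/negP.
  by rewrite lt_min => /andP[/eK].
exists (MkC0 bC0); split => /=.
- by move=> x; rewrite metric_bump_ge0 metric_bump_le1.
- exact: metric_bump_center.
move=> x Ux; apply: metric_bump_eq0 => //; rewrite leNgt; apply/negP.
by rewrite lt_min => /andP[_ /rU].
Qed.

Lemma compact_cutoff (K : set E) : compact K ->
  exists psi : E -> R, [/\ continuous psi, forall x, 0 <= psi x <= 1,
    forall x, K x -> psi x = 1 &
    exists2 L, compact L & forall x, ~ L x -> psi x = 0].
Proof.
move=> cK.
have /choice[e he] := locally_compact_ball.
have /choice[KK hKK] : forall p, exists K', compact K' /\
    [set x | d p x < e p] `<=` K'.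
  by move=> p; have [_ [K' ? ?]] := he p; exists K'.
have e0 p : 0 < e p by have [] := he p.
have oV p : [set: E] p -> open [set x | 2^-1 < metric_bump p (e p) x].
  move=> _; apply: (@open_comp _ _ (metric_bump p (e p)) [set y | 2^-1 < y]).
    by move=> x _; exact: metric_bump_continuous.
  exact: open_gt.
have KV : K `<=` cover [set: E] (fun p => [set x | 2^-1 < metric_bump p (e p) x]).
  by move=> x Kx; exists x => //=; rewrite metric_bump_center invf_lt1// ltr1n.
have cK' : cover_compact K by rewrite -compact_cover.
have [D _ KD] := cK' _ _ _ oV KV.
pose S x := \sum_(p <- D) metric_bump p (e p) x.
have S0 x : 0 <= S x by apply: sumr_ge0 => p _; exact: metric_bump_ge0.
have cS : continuous S.
  by move=> x; apply: cvgr_sum => p; exact: metric_bump_continuous.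
(* On [K] some bump of the finite cover exceeds 1/2, so twice the sum reaches the cap 1. *)
exists (fun x => Num.min 1 (2 * S x)); split.
- move=> x; apply: (@continuous_min _ _ (fun=> 1) (fun x => 2 * S x)).
    exact: cst_continuous.
  by apply: cvgM; [exact: cvg_cst|exact: cS].
- by move=> x; rewrite le_min ler01/= mulr_ge0//= ge_min lexx.
- move=> x /KD[p /= pD px]; apply/min_idPl.
  rewrite -ler_pdivrMl// mulr1 (le_trans (ltW px))// /S (big_fsetD1 p)//= lerDl.
  by apply: sumr_ge0 => q _; exact: metric_bump_ge0.
exists (\bigcup_(p in [set` D]) KK p).
  rewrite bigcup_fset; apply: (big_ind (@compact E)).
  - exact: compact0.
  - by move=> ? ?; exact: compactU.
  - by move=> p _; have [] := hKK p.
move=> x nx; rewrite (_ : S x = 0) ?mulr0 ?min_r//.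
rewrite /S big_seq big1// => p pD; apply: metric_bump_eq0 => //.
by rewrite leNgt; apply/negP => px; apply: nx; exists p => //; apply: (hKK p).2.
Qed.

End metrizable.

(** * Regularity of Borel measures *)

(** Continuity from above along the sets left over by the finite unions. *)
Lemma measure_setD_bigsetU_lt d (T : measurableType d) (R : realType)
    (mu : {finite_measure set T -> \bar R}) (F : (set T)^nat) (U : set T)
    (e : R) : 0 < e -> measurable U -> (forall n, measurable (F n)) ->
  exists N, (mu (U `\` \big[setU/set0]_(n < N) F n) <
             mu (U `\` \bigcup_n F n) + e%:E)%E.
Proof.
move=> e0 mU mF.
pose G N := U `\` \big[setU/set0]_(n < N) F n.
have mG N : measurable (G N).
  by apply: measurableD => //; apply: bigsetU_measurable.
have GE : \bigcap_N G N = U `\` \bigcup_n F n.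
  apply/seteqP; split => [x Gx|x [Ux nx] N _].
    split; first by have [] := Gx 0%N I.
    move=> [n _ Fx]; have [_] := Gx n.+1 I; apply.
    by rewrite big_ord_recr/=; right.
  split => //; rewrite -bigcup_mkord => -[n /= _ Fx]; apply: nx.
  by exists n.
have mGI : measurable (\bigcap_N G N) by exact: bigcap_measurable.
have : mu \o G @ \oo --> mu (\bigcap_N G N).
  apply: nonincreasing_cvg_mu => //.
    by rewrite ltey_eq fin_num_measure.
  move=> m n mn; apply/subsetPset; apply: setDS.
  exact: subset_bigsetU.
rewrite GE => cv.
have fU : mu (U `\` \bigcup_n F n) \is a fin_num.
  by rewrite fin_num_measure// -GE.
have lt : (mu (U `\` \bigcup_n F n) < mu (U `\` \bigcup_n F n) + e%:E)%E.
  by rewrite lteDl.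
have [N _ /(_ N (leqnn _)) HN] :=
  cv _ (open_nbhs_nbhs (conj (@open_ereal_lt_ereal R _) lt)).
by exists N.
Qed.

Section borel_regularity.
Context {R : realType} {E : ptopologicalType} {d : E -> E -> R}.
Hypotheses (d_metric : is_metric d) (d_topology : induces_topology d).
Hypotheses (E_locally_compact : locally_compact [set: E])
  (E_hausdorff : hausdorff_space E) (E_second_countable : @second_countable E).

(** The members of a countable base whose closure is compact and contained in [U] already cover
    [U]. *)
Lemma open_sigma_compact (U : set E) : open U ->
  exists2 K : nat -> set E, (forall n, compact (K n)) & U = \bigcup_n K n.
Proof.
move=> oU; have [B cB [Bo Bb]] := E_second_countable.
pose D := [set b | [/\ B b, compact (closure b) & closure b `<=` U]].
have UD x : U x -> exists2 b, D b & b x.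
  move=> Ux; have /d_topology[r r0 rU] : nbhs x U by exact: open_nbhs_nbhs.
  have [e [e0 [K cK eK]]] := locally_compact_ball d_topology E_locally_compact x.
  (* Halving puts the closed ball of radius [m], and with it the closure of the basic set, inside
     the open balls of radii [e] and [r]. *)
  pose m := Num.min e r / 2.
  have mer : 0 < Num.min e r by rewrite lt_min e0.
  have m0 : 0 < m by rewrite divr_gt0.
  have mlt : m < Num.min e r by rewrite /m ltr_pdivrMr// ltr_pMr// ltr1n.
  have : nbhs x [set y | d x y < m] by apply/d_topology; exists m.
  move=> /(Bb x)[b [/= Bb' bx] bm]; exists b => //.
  have clb : closure b `<=` [set y | d x y <= m].
    rewrite (closure_id [set y | d x y <= m]).1.
      by apply: closureS => y /bm /= /ltW.
    apply: (@closed_comp _ _ (d x) [set z | z <= m]); last exact: closed_le.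
    by move=> y _; exact: metric_dist_continuous.
  split => //.
    apply: (subclosed_compact _ cK); first exact: closed_closure.
    move=> y /clb /= dm; apply: eK => /=; apply: (le_lt_trans dm).
    by apply: (lt_le_trans mlt); rewrite ge_min lexx.
  move=> y /clb /= dm; apply: rU => /=; apply: (le_lt_trans dm).
  by apply: (lt_le_trans mlt); rewrite ge_min lexx orbT.
have cD : countable D by apply: sub_countable cB; apply: subset_card_le => b [].
have [D0|[g]] := pfcard_geP cD.
  exists (fun=> set0) => [n|]; first exact: compact0.
  rewrite bigcup0//; apply/seteqP; split => // x /UD[b].
  by rewrite D0.
exists (fun n => closure (g n)) => [n|].
  by have [] : D (g n) by exact: funS.
apply/seteqP; split => [x /UD[b Db bx]|x [n _]].
  have [n _ gn] := @surj _ _ _ _ g b Db.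
  by exists n => //; rewrite gn; exact: subset_closure.
have [_ _ gU] : D (g n) by exact: funS.
exact: gU.
Qed.

Lemma borel_open (U : set E) : open U -> measurable (U : set (borel E)).
Proof. exact: sub_sigma_algebra. Qed.

Lemma borel_closed (C : set E) : closed C -> measurable (C : set (borel E)).
Proof.
move=> cC; rewrite -[C]setCK.
exact: (measurableC (borel_open (closed_openC cC))).
Qed.

Lemma borel_compact (K : set E) : compact K -> measurable (K : set (borel E)).
Proof. by move=> cK; exact: borel_closed (compact_closed E_hausdorff cK). Qed.

Variable mu : {finite_measure set (borel E) -> \bar R}.

(** The sets with this approximation property form a sigma-algebra. It contains the open sets
    because these are countable unions of compact sets. *)
Lemma borel_closed_open_regular (A : set (borel E)) : measurable A ->
  forall e : R, 0 < e -> exists C U : set E,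
  [/\ closed C, open U, C `<=` A, A `<=` U & (mu (U `\` C) < e%:E)%E].
Proof.
pose G (A : set (borel E)) := forall e : R, 0 < e -> exists C U : set E,
  [/\ closed C, open U, C `<=` A, A `<=` U & (mu (U `\` C) < e%:E)%E].
suff : <<s @open E >> `<=` G by exact.
apply: smallest_sub; [split|].
- move=> e e0; exists set0, set0; split => //.
  + exact: closed0.
  + exact: open0.
  + by rewrite setD0 measure0.
- move=> B GB e e0; have [C [U [cC oU CB BU lt]]] := GB e e0.
  exists (~` U), (~` C); split.
  + exact: open_closedC.
  + exact: closed_openC.
  + by rewrite setTD; exact: subsetC.
  + by rewrite setTD; exact: subsetC.
  + by rewrite setDE setCK setIC -setDE.
- move=> F GF e e0.
  (* The errors of the individual sets sum to [e / 2]; the other half pays for cutting the union of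
     the closed sets down to a finite, hence closed, one. *)
  have e20 n : 0 < e / 2 / (2 ^ n.+1)%:R :> R.
    by rewrite !divr_gt0// ltr0n expn_gt0.
  have /choice[C /choice[U CU]] n := GF n _ (e20 n).
  have mC n : measurable (C n : set (borel E)).
    by have [cC _ _ _ _] := CU n; exact: borel_closed.
  have mU n : measurable (U n : set (borel E)).
    by have [_ oU _ _ _] := CU n; exact: borel_open.
  have mbU : measurable (\bigcup_n U n : set (borel E)).
    exact: bigcupT_measurable.
  have e2 : 0 < e / 2 by rewrite divr_gt0.
  have [N HN] := measure_setD_bigsetU_lt mu e2 mbU mC.
  exists (\big[setU/set0]_(n < N) C n), (\bigcup_n U n); split.
  + by apply: closed_bigsetU => i _; have [] := CU i.
  + by apply: bigcup_open => i _; have [] := CU i.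
  + rewrite -bigcup_mkord => x [n _ Cx]; exists n => //.
    by have [_ _ + _ _] := CU n; exact.
  + move=> x [n _ Fx]; exists n => //.
    by have [_ _ _ + _] := CU n; exact.
  + apply: (lt_le_trans HN); rewrite [e in leRHS]splitr EFinD leeD2r//.
    have mD n : measurable (U n `\` C n : set (borel E)) by exact: measurableD.
    have : (mu ((\bigcup_n U n) `\` \bigcup_n C n) <=
        \sum_(n <oo) mu (U n `\` C n))%E.
      apply: measure_sigma_subadditive => //.
        by apply: measurableD => //; exact: bigcupT_measurable.
      move=> x [[n _ Ux] nC]; exists n => //; split => // Cx; apply: nC.
      by exists n.
    move=> /le_trans; apply.
    apply: le_trans (epsilon_trick0 xpredT (ltW e2)).
    apply: lee_nneseries => //= n _.
    by have [_ _ _ _ /ltW] := CU n.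
- move=> U oU e e0.
  have [K cK UK] := open_sigma_compact oU.
  have mK n : measurable (K n : set (borel E)) by exact: borel_compact.
  have [N] := measure_setD_bigsetU_lt mu e0 (borel_open oU) mK.
  rewrite -UK setDv measure0 add0e => HN.
  exists (\big[setU/set0]_(n < N) K n), U; split => //.
    by apply: closed_bigsetU => i _; exact: compact_closed.
  by rewrite [in X in _ `<=` X]UK -bigcup_mkord => x [n _ ?]; exists n.
Qed.

(** The closed inner approximation becomes compact after intersection with a compact set [F] that
    misses mass less than [e / 2]. *)
Lemma borel_regular (A : set (borel E)) (e : R) : 0 < e -> measurable A ->
  exists K U : set E, [/\ compact K, open U, K `<=` A, A `<=` U &
    (mu (A `\` K) < e%:E)%E /\ (mu (U `\` A) < e%:E)%E].
Proof.
move=> e0 mA; have e2 : 0 < e / 2 by rewrite divr_gt0.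
have [C [U [cC oU CA AU lt]]] := borel_closed_open_regular mA e2.
have [K cK EK] := open_sigma_compact (@openT E).
have mK n : measurable (K n : set (borel E)) by exact: borel_compact.
have [N] := measure_setD_bigsetU_lt mu e2 measurableT mK.
rewrite -EK setDv measure0 add0e => HN.
set F := \big[setU/set0]_(n < N) K n in HN.
have cF : compact F.
  apply: (big_ind (@compact E)) => //; first exact: compact0.
  by move=> ? ?; exact: compactU.
have mC := borel_closed cC; have mF := borel_compact cF.
have mU := borel_open oU.
exists (C `&` F), U; split => //.
- by apply: (subclosed_compact _ cF); [apply: closedI => //; exact: compact_closed|].
- by move=> x [/CA].
split; last first.
  apply: (@le_lt_trans _ _ (mu (U `\` C))).
    apply: le_measure; rewrite ?inE; [exact: measurableD|exact: measurableD|].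
    exact: setDS.
  by apply: (lt_trans lt); rewrite lte_fin ltr_pdivrMr// ltr_pMr// ltr1n.
apply: (@le_lt_trans _ _ (mu ((U `\` C) `|` (setT `\` F)))).
  apply: le_measure; rewrite ?inE; [by apply: measurableD => //; exact: measurableI| |].
    by apply: measurableU; exact: measurableD.
  move=> x [Ax nx]; have [Cx|Cx] := pselect (C x).
    by right; split => // Fx; exact: nx.
  by left; split => //; exact: AU.
apply: (le_lt_trans (measureU2 _ _ _)); [exact: measurableD|exact: measurableD|].
by rewrite [e]splitr EFinD lteD.
Qed.

End borel_regularity.

(** * Limits of couplings *)

Lemma measure_probability d (T : measurableType d) (R : realType)
    (m : {measure set T -> \bar R}) : m setT = 1%E ->
  exists P : probability T R, forall S, P S = m S.
Proof.
move=> m1; pose f S := m S.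
pose fM := isMeasure.Build _ _ _ f (measure0 m) (measure_ge0 m)
  (@measure_semi_sigma_additive _ _ _ m).
pose fM' : {measure set T -> \bar R} := HB.pack f fM.
pose fP := Measure_isProbability.Build _ _ _ fM' m1.
pose P : probability T R := HB.pack f fM fP.
by exists P.
Qed.

(** By compactness of the segment the image filter clusters at some point, and an ultrafilter
    converges to each of its cluster points. *)
Lemma ultra_is_cvg (R : realType) (T : Type) (G : set_system T) (u : T -> R)
    (a b : R) : UltraFilter G -> (forall x, a <= u x <= b) -> cvg (u @ G).
Proof.
move=> UG uab; have PG : ProperFilter G by exact: ultra_proper.
have Gab : G (u @^-1` [set` `[a, b]]).
  by apply: filterE => x; rewrite /= in_itv/= uab.
have [p [_ pu]] := @segment_compact R a b (u @ G) _ Gab.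
apply/cvg_ex; exists p => /= V pV.
have [//|GV] := in_ultra_setVsetC (u @^-1` V) UG.
by have [y [nVy Vy]] := pu (~` V) V GV pV.
Qed.

HB.instance Definition _ (T U : ptopologicalType) := Pointed.on (T * U)%type.

Lemma open_setX (T U : topologicalType) (A : set T) (B : set U) :
  open A -> open B -> open (A `*` B).
Proof.
move=> oA oB; rewrite openE => -[x y] [/= Ax By]; exists (A, B) => //=.
by split; exact: open_nbhs_nbhs.
Qed.

(** * The semiring of measurable rectangles *)

Definition rectangle {d1 d2 : measure_display} (T1 : measurableType d1)
  (T2 : measurableType d2) : Type := (T1 * T2)%type.

(** Together with the alias [rectangle], this opaque display lets the product type carry the
    semiring of rectangles beside its product sigma-algebra. *)
Definition rectangle_display : measure_display -> measure_display ->
  measure_display.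
Proof. by []. Qed.

Section rectangle_semiring.
Context {d1 d2 : measure_display} (T1 : measurableType d1)
  (T2 : measurableType d2).

HB.instance Definition _ := Pointed.on (rectangle T1 T2).

Definition is_rectangle : set (set (rectangle T1 T2)) :=
  [set A `*` B | A in measurable & B in measurable].

Lemma is_rectangle0 : is_rectangle set0.
Proof. by exists set0 => //; exists set0 => //; rewrite set0X. Qed.

Lemma is_rectangleI : setI_closed is_rectangle.
Proof.
move=> _ _ [A mA [B mB <-]] [A' mA' [B' mB' <-]].
exists (A `&` A'); first exact: measurableI.
exists (B `&` B'); first exact: measurableI.
by rewrite setXI.
Qed.

Lemma is_rectangleD : semi_setD_closed is_rectangle.
Proof.
move=> _ _ [A mA [B mB <-]] [A' mA' [B' mB' <-]].
(* The difference of two rectangles splits into two disjoint ones, according to whether the first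
   coordinate lies in [A']. *)
pose C := (A `\` A') `*` B; pose D := (A `&` A') `*` (B `\` B').
exists [set C; D]; split.
- exact: finite_set2.
- move=> _ [->|->].
    by exists (A `\` A'); [exact: measurableD|exists B].
  by exists (A `&` A'); [exact: measurableI|exists (B `\` B'); [exact: measurableD|]].
- rewrite bigcup_setU !bigcup_set1; apply/seteqP; split => -[x y] /=.
    move=> [[Ax By] nxy]; have [A'x|A'x] := pselect (A' x).
      by right; split => //; split => // B'y; exact: nxy.
    by left.
  by move=> [[[? ?] ?]|[[? ?] [? ?]]]; split => // -[].
- apply/trivIsetP => _ _ [->|->] [->|->]//; rewrite ?eqxx// => _.
    by rewrite -subset0 => -[x y] [[[_ ?] _] [[_ ?] _]].
  by rewrite -subset0 => -[x y] [[[_ ?] _] [[_ ?] _]].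
Qed.

HB.instance Definition _ := isSemiRingOfSets.Build (rectangle_display d1 d2)
  (rectangle T1 T2) is_rectangle0 is_rectangleI is_rectangleD.

End rectangle_semiring.

(** Outside [K * L], a point of [A * B] lies in a strip over [A \ K] or over [B \ L], whose mass is
    fixed by a marginal. The error is therefore the same for all couplings and survives a limit. *)
Lemma coupling_setXB (R : realType) (E : ptopologicalType)
    (mu nu : probability (borel E) R)
    (g : probability (borel E * borel E)%type R) (A B K L : set (borel E)) :
  coupling mu nu g -> measurable A -> measurable B -> measurable K ->
  measurable L ->
  fine (g (A `*` B)) <= fine (g (K `*` L)) + fine (mu (A `\` K)) +
    fine (nu (B `\` L)).
Proof.
move=> cg mA mB mK mL.
have mAK := measurableD mA mK; have mBL := measurableD mB mL.
have [<- _] := cg _ mAK; have [_ <-] := cg _ mBL.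
have m1 : measurable (K `*` L) by exact: measurableX.
have m2 : measurable ((A `\` K) `*` [set: borel E]) by exact: measurableX.
have m3 : measurable ([set: borel E] `*` (B `\` L)) by exact: measurableX.
rewrite -!fineD ?fin_numD ?fin_num_measure// fine_le ?fin_numD ?fin_num_measure//.
  exact: measurableX.
apply: (@le_trans _ _ (g (K `*` L `|` (A `\` K) `*` setT `|` setT `*` (B `\` L)))).
  apply: le_measure; rewrite ?inE; first exact: measurableX.
    by apply: measurableU => //; exact: measurableU.
  move=> [x y] [/= Ax By]; have [Kx|Kx] := pselect (K x); last by left; right.
  by have [Ly|Ly] := pselect (L y); [left; left|right].
apply: (le_trans (measureU2 _ _ _)) => //; first exact: measurableU.
by rewrite leeD2r// measureU2.
Qed.

Section coupling_limit.
Context {R : realType} {E : ptopologicalType}.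
Hypothesis E_regular : forall (mu : {finite_measure set (borel E) -> \bar R})
    (A : set (borel E)) (e : R), 0 < e -> measurable A ->
  exists K U : set E, [/\ compact K, open U, K `<=` A, A `<=` U &
    (mu (A `\` K) < e%:E)%E /\ (mu (U `\` A) < e%:E)%E].
Hypothesis E_hausdorff : hausdorff_space E.
Variables (mu nu : probability (borel E) R)
  (g : nat -> probability (borel E * borel E)%type R) (G : set_system nat).
Hypotheses (UG : UltraFilter G) (cg : forall n, coupling mu nu (g n)).

Let PG : ProperFilter G. Proof. exact: ultra_proper. Qed.

(* Truncated at [1] so that the limit exists on all sets. *)
Let v (S : set (borel E * borel E)%type) n := Num.min 1 (fine (g n S)).

Let c (S : set (borel E * borel E)%type) : R := lim (v S @ G).

Let vE S n : measurable S -> v S n = fine (g n S).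
Proof.
move=> mS; apply/min_idPr; rewrite -[leRHS]fine1 fine_le ?fin_num_measure//.
exact: probability_le1.
Qed.

Let v01 S n : 0 <= v S n <= 1.
Proof. by rewrite le_min ler01 fine_ge0//= ge_min lexx. Qed.

Let vc S : v S @ G --> c S.
Proof. by apply: (@ultra_is_cvg _ _ _ _ 0 1). Qed.

Let c_ge0 S : 0 <= c S.
Proof.
by apply: (cvgr_to_ge (@vc S)); apply: filterE => n; have /andP[] := v01 S n.
Qed.

Let mR (S : set (borel E * borel E)%type) :
  @is_rectangle _ _ (borel E) (borel E) S -> measurable S.
Proof. by move=> [A mA [B mB <-]]; exact: measurableX. Qed.

Let c_additive : measure_function.semi_additive
  (fun S : set (rectangle (borel E) (borel E)) => (c S)%:E).
Proof.
move=> F n mF tF mUF; rewrite sumEFin; congr EFin.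
have := @vc (\big[setU/set0]_(i < n) F i).
rewrite (_ : v _ = fun m => \sum_(i < n) v (F i) m); last first.
  apply/funext => m; rewrite (vE _ (mR mUF)).
  rewrite measure_semi_additive_ord_I//.
  - rewrite -sum_fine => [|i _]; last exact: fin_num_measure (mR (mF i)).
    by apply: eq_bigr => i _; rewrite (vE _ (mR (mF i))).
  - by move=> k _; exact: mR (mF k).
  - exact: sub_trivIset tF.
  - exact: mR mUF.
move=> H; apply: (cvg_unique _ H) => //.
apply: (@cvgr_sum _ _ 'I_n _ _ (fun i => v (F i)) (fun i => c (F i))) => i.
exact: vc.
Qed.

Let c_setXB A B K L : measurable A -> measurable B -> measurable K ->
  measurable L ->
  c (A `*` B) <= c (K `*` L) + fine (mu (A `\` K)) + fine (nu (B `\` L)).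
Proof.
move=> mA mB mK mL.
have vKL : v (K `*` L) n + fine (mu (A `\` K)) + fine (nu (B `\` L)) @[n --> G] -->
    c (K `*` L) + fine (mu (A `\` K)) + fine (nu (B `\` L)).
  by apply: cvgD; [apply: cvgD; [exact: vc|exact: cvg_cst]|exact: cvg_cst].
apply: (ler_cvg_to (@vc (A `*` B)) vKL).
apply: filterE => n /=; rewrite (vE _ (measurableX mA mB)) (vE _ (measurableX mK mL)).
exact: coupling_setXB.
Qed.

(** Regularity of the marginals shrinks [A * B] to a compact [K * L] and enlarges each [F n] to an
    open rectangle. A finite subcover reduces the claim to finite subadditivity of each [g m], which
    passes to the limit. *)
Let c_subadditive :
  measurable_subset_sigma_subadditive
    (fun S : set (rectangle (borel E) (borel E)) => (c S)%:E).
Proof.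
move=> _ F mF [A mA [B mB <-]] ABF.
have /choice[FA /choice[FB FE]] (n : nat) : exists A B, [/\
    measurable (A : set (borel E)), measurable (B : set (borel E)) &
    A `*` B = F n].
  by have [A' mA' [B' mB' <-]] := mF n; exists A', B'.
apply/lee_addgt0Pr => e e0.
have e4 : 0 < e / 4 by rewrite divr_gt0.
have [K [_ [cK _ KA _ [/ltW muK _]]]] := E_regular mu e4 mA.
have [L [_ [cL _ LB _ [/ltW nuL _]]]] := E_regular nu e4 mB.
(* Two sides per rectangle cost [e / 2 / 2 ^ n.+1], in total [e / 2]; the remaining [e / 2] covers
   the passage from [A * B] to [K * L]. *)
pose r n := e / 4 / (2 ^ n.+1)%:R.
have r0 n : 0 < r n by rewrite divr_gt0// ltr0n expn_gt0.
have mFA n : measurable (FA n) by have [] := FE n.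
have mFB n : measurable (FB n) by have [] := FE n.
have /choice[U hU] n : exists U : set E, [/\ open U, FA n `<=` U &
    (mu (U `\` FA n) <= (r n)%:E)%E].
  have [_ [U [_ oU _ AU [_ /ltW]]]] := E_regular mu (r0 n) (mFA n).
  by exists U.
have /choice[V hV] n : exists U : set E, [/\ open U, FB n `<=` U &
    (nu (U `\` FB n) <= (r n)%:E)%E].
  have [_ [U' [_ oU _ AU [_ /ltW]]]] := E_regular nu (r0 n) (mFB n).
  by exists U'.
have mK := borel_compact E_hausdorff cK; have mL := borel_compact E_hausdorff cL.
have mU n : measurable (U n : set (borel E)).
  by have [oU _ _] := hU n; exact: borel_open.
have mV n : measurable (V n : set (borel E)).
  by have [oU _ _] := hV n; exact: borel_open.
have fineW (m : probability (borel E) R) X a : measurable X ->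
    (m X <= a%:E)%E -> fine (m X) <= a.
  by move=> mX; rewrite -lee_fin fineK ?fin_num_measure.
have cAB : c (A `*` B) <= c (K `*` L) + e / 2.
  apply: (le_trans (c_setXB mA mB mK mL)); rewrite -addrA lerD2l.
  have := fineW _ _ _ (measurableD mA mK) muK.
  have := fineW _ _ _ (measurableD mB mL) nuL.
  lra.
have cUV n : c (U n `*` V n) <= c (F n) + e / 2 / (2 ^ n.+1)%:R.
  have [_ _ <-] := FE n.
  apply: (le_trans (c_setXB (mU n) (mV n) (mFA n) (mFB n))).
  rewrite -addrA lerD2l.
  have [_ _ h1] := hU n; have [_ _ h2] := hV n.
  have := fineW _ _ _ (measurableD (mU n) (mFA n)) h1.
  have := fineW _ _ _ (measurableD (mV n) (mFB n)) h2.
  rewrite /r => ? ?.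
  have -> : e / 2 / (2 ^ n.+1)%:R = e / 4 / (2 ^ n.+1)%:R + e / 4 / (2 ^ n.+1)%:R.
    by field; rewrite pnatr_eq0 expn_eq0.
  exact: lerD.
have cKL : compact (K `*` L : set (E * E)) by exact: compact_setX.
have oUV n : [set: nat] n -> open (U n `*` V n : set (E * E)).
  move=> _; have [oU _ _] := hU n; have [oV _ _] := hV n.
  exact: open_setX.
have KLUV : (K `*` L : set (E * E)) `<=` cover [set: nat] (fun n => U n `*` V n).
  move=> [x y] [/= Kx Ly].
  have [n _] : (\bigcup_n F n) (x, y) by apply: ABF; split; [exact: KA|exact: LB].
  have [_ _ <-] := FE n => -[/= Ax By]; exists n => //; split => /=.
    by have [_ + _] := hU n; exact.
  by have [_ + _] := hV n; exact.
have [D _ KLD] : finite_subset_cover [set: nat] (fun n => U n `*` V n)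
    (K `*` L : set (E * E)).
  have cc : @cover_compact (E * E)%type (K `*` L) by rewrite -compact_cover.
  exact: cc.
(* An initial segment of indices that contains the finite subcover. *)
pose N := (\max_(i <- D) i).+1.
have KLN : K `*` L `<=` \big[setU/set0]_(n < N) (U n `*` V n).
  move=> x /KLD[n /= nD xn]; rewrite -(bigcup_mkord N (fun n => U n `*` V n)).
  exists n; last exact: xn.
  by rewrite /= /N ltnS; exact: leq_bigmax_seq.
have cKLle : c (K `*` L) <= \sum_(n < N) c (U n `*` V n).
  apply: (ler_cvg_to (@vc (K `*` L)) (@cvgr_sum _ _ 'I_N _ _
    (fun n => v (U n `*` V n)) (fun n => c (U n `*` V n)) _
    (fun n => @vc (U n `*` V n)))).
  have mUV k : measurable (U k `*` V k : set (borel E * borel E)%type).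
    exact: measurableX.
  apply: filterE => m; rewrite (vE _ (measurableX mK mL)).
  under eq_bigr do rewrite (vE _ (mUV _)).
  rewrite -lee_fin -sumEFin fineK; last exact: fin_num_measure (measurableX mK mL).
  under eq_bigr do rewrite (fineK (fin_num_measure _ _ (mUV _))).
  apply: (@content_subadditive _ _ _ (g m) (K `*` L) (fun n => U n `*` V n) N).
  - by move=> k _; exact: measurableX.
  - exact: measurableX.
  - exact: KLN.
apply: (@le_trans _ _ (\sum_(n < N) c (U n `*` V n) + e / 2)%:E).
  by rewrite lee_fin (le_trans cAB)// lerD2r.
rewrite [e in leRHS]splitr !EFinD addeA leeD2r//.
have e2 : 0 <= e / 2 by rewrite divr_ge0// ltW.
apply: le_trans (@epsilon_trick R (fun n => (c (F n))%:E) (e / 2) xpredT _ e2).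
  apply: le_trans (nneseries_lim_ge N _).
    by rewrite -sumEFin big_mkord; apply: lee_sum => n _; rewrite -EFinD lee_fin.
  by move=> n _ _; rewrite -EFinD lee_fin addr_ge0// divr_ge0.
by move=> n; rewrite lee_fin.
Qed.

(** The limit content on rectangles is countably subadditive, so Caratheodory's theorem extends it
    to the product sigma-algebra. The marginals do not vary with [n], hence are those of the
    limit. *)
Lemma coupling_limit :
  exists2 ga : probability (borel E * borel E)%type R, coupling mu nu ga &
  forall A B, measurable A -> measurable B ->
    fine (g n (A `*` B)) @[n --> G] --> fine (ga (A `*` B)).
Proof.
pose c' (S : set (rectangle (borel E) (borel E))) := (c S)%:E.
have c'0 S : (0 <= c' S)%E by rewrite lee_fin.
pose cC := isContent.Build _ _ _ c' c'0 c_additive.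
pose cC' : {content set (rectangle (borel E) (borel E)) -> \bar R} :=
  HB.pack c' cC.
pose cS := Content_SigmaSubAdditive_isMeasure.Build _ _ _ cC' c_subadditive.
pose cM : {measure set (rectangle (borel E) (borel E)) -> \bar R} :=
  HB.pack c' cC cS.
pose f (S : set (borel E * borel E)%type) : \bar R := measure_extension cM S.
have fE A B : measurable A -> measurable B -> f (A `*` B) = (c (A `*` B))%:E.
  by move=> mA mB; rewrite /f /measure_extension measurable_mu_extE//; exists A => //; exists B.
have f0 : f set0 = 0%E by exact: measure0.
have f_ge0 S : (0 <= f S)%E by exact: measure_ge0.
have fs : semi_sigma_additive f.
  move=> F mF tF mUF; apply: measure_semi_sigma_additive => //.
    by move=> i; have := mF i; rewrite measurable_prod_measurableType.
  by have := mUF; rewrite measurable_prod_measurableType.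
have lc A B : measurable A -> measurable B ->
    fine (g n (A `*` B)) @[n --> G] --> c (A `*` B).
  move=> mA mB; have := @vc (A `*` B).
  rewrite (_ : v _ = fun n => fine (g n (A `*` B)))//.
  by apply/funext => n; exact: vE (measurableX mA mB).
have lcu A B l : measurable A -> measurable B ->
    (forall n, g n (A `*` B) = l) -> l \is a fin_num -> f (A `*` B) = l.
  move=> mA mB gl fl; rewrite fE// -[RHS]fineK//; congr EFin.
  apply: (cvg_unique _ (lc A B mA mB)) => //.
  rewrite (_ : (fun n => fine (g n (A `*` B))) = fun=> fine l).
    exact: cvg_cst.
  by apply/funext => n; rewrite gl.
have fT : f setT = 1%E.
  rewrite -setXTT; apply: lcu => // n; rewrite setXTT; exact: probability_setT.
pose fM := isMeasure.Build _ _ _ f f0 f_ge0 fs.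
pose fM' : {measure set (borel E * borel E)%type -> \bar R} := HB.pack f fM.
have [ga gaE] := @measure_probability _ _ _ fM' fT.
exists ga => [A mA|A B mA mB]; last first.
  by rewrite gaE /= fE//; exact: lc.
split; rewrite gaE /=; apply: lcu => //.
- by move=> n; have [] := cg n mA.
- exact: fin_num_measure.
- by move=> n; have [] := cg n mA.
- exact: fin_num_measure.
Qed.

End coupling_limit.

(** * Couplings from finite partitions *)

Section probability_integral.
Context {d : measure_display} {T : measurableType d} {R : realType}.
Variable P : probability T R.

Lemma bounded_integrable (f : T -> R) (M : R) : measurable_fun setT f ->
  (forall x, `|f x| <= M) -> P.-integrable setT (EFin \o f).
Proof.
move=> mf fM; apply: measurable_bounded_integrable => //.
  by rewrite -ge0_fin_numE// fin_num_measure.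
exists M; split; first exact: num_real.
by move=> y My x _; exact: le_trans (fM x) (ltW My).
Qed.

Lemma Rintegral_prob_cst (r : R) : \int[P]_x r = r.
Proof. by rewrite Rintegral_cst//= probability_setT mulr1. Qed.

Lemma Rintegral_dist_le (f g : T -> R) (M M' e : R) : measurable_fun setT f ->
  measurable_fun setT g -> (forall x, `|f x| <= M) -> (forall x, `|g x| <= M') ->
  (forall x, `|f x - g x| <= e) -> `|\int[P]_x f x - \int[P]_x g x| <= e.
Proof.
move=> mf mg fM gM fge.
have If := bounded_integrable mf fM; have Ig := bounded_integrable mg gM.
have mfg : measurable_fun setT (fun x => f x - g x) by exact: measurable_funB.
have Ifg := bounded_integrable mfg fge.
rewrite -RintegralB//; apply: (le_trans (le_normr_Rintegral _ Ifg)) => //.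
rewrite -[leRHS]Rintegral_prob_cst le_Rintegral//.
  exact: integrable_norm.
exact: finite_measure_integrable_cst.
Qed.

Context {J : finType} (h : T -> J).
Hypothesis mh : forall j, measurable (h @^-1` [set j]).

Lemma fin_valued_measurable d' (U : measurableType d') (D : J -> U) :
  measurable_fun setT (D \o h).
Proof.
move=> _ Y mY; rewrite setTI.
have -> : (D \o h) @^-1` Y = \bigcup_(j in [set j | Y (D j)]) h @^-1` [set j].
  apply/seteqP; split => [x Yx|x [j /= Yj hj]].
    by exists (h x).
  by rewrite /= hj.
apply: fin_bigcup_measurable => //; exact: finite_finset.
Qed.

Lemma measure_fin_fibers (A : set T) : measurable A ->
  fine (P A) = \sum_j fine (P (A `&` h @^-1` [set j])).
Proof.
move=> mA; have mAj j : measurable (A `&` h @^-1` [set j]) by exact: measurableI.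
rewrite sum_fine => [|j _]; last exact: fin_num_measure.
congr fine; rewrite bigfs ?index_enum_uniq => [|//|j _]; last first.
  by rewrite mem_index_enum.
rewrite -measure_fin_bigcup//.
- congr (P _); apply/seteqP; split => [x Ax|x [j _ []]//].
  by exists (h x).
- apply/trivIsetP => i j _ _ ij; rewrite -subset0 => x [[_ /= hi] [_ /= hj]].
  by move: ij; rewrite -hi -hj eqxx.
Qed.

Lemma Rintegral_fin_valued (D : J -> R) :
  \int[P]_x D (h x) = \sum_j D j * fine (P (h @^-1` [set j])).
Proof.
have DE x : (D (h x))%:E = (\sum_j (D j)%:E * (\1_(h @^-1` [set j]) x)%:E)%E.
  rewrite (bigD1 (h x))//= big1 => [|j jx].
    by rewrite indicE mem_set//= mule1 adde0.
  by rewrite indicE memNset ?mule0//= => /esym/eqP; rewrite (negbTE jx).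
rewrite /Rintegral; under eq_integral do rewrite DE.
rewrite integral_sum// => [|j]; last first.
  by apply: integrableZl => //; exact: integrable_indic.
rewrite -sum_fine => [|j _].
  apply: eq_bigr => j _; rewrite integralZl//; last exact: integrable_indic.
  by rewrite integral_indic// setIT fineM// fin_num_measure.
by apply: integrable_fin_num => //; apply: integrableZl => //; exact: integrable_indic.
Qed.

End probability_integral.

Section cell_coupling.
Context {R : realType} {E : ptopologicalType}.
Variables (mu nu : probability (borel E) R) (I : finType) (h : borel E -> I).
Hypothesis mh : forall i, measurable (h @^-1` [set i]).
Variable pi : I -> I -> R.
Let mu_ i := fine (mu (h @^-1` [set i])).
Let nu_ i := fine (nu (h @^-1` [set i])).
Hypotheses (pi_ge0 : forall i j, 0 <= pi i j)
  (pi_row : forall i, \sum_j pi i j = mu_ i)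
  (pi_col : forall j, \sum_i pi i j = nu_ j).

Let pi_row0 i j : mu_ i = 0 -> pi i j = 0.
Proof.
rewrite -pi_row => /eqP; rewrite psumr_eq0// => /allP/(_ j).
by rewrite mem_index_enum => /(_ isT)/eqP.
Qed.

Let pi_col0 i j : nu_ j = 0 -> pi i j = 0.
Proof.
rewrite -pi_col => /eqP; rewrite psumr_eq0// => /allP/(_ i).
by rewrite mem_index_enum => /(_ isT)/eqP.
Qed.

Let mu_ge0 i : 0 <= mu_ i. Proof. exact: fine_ge0. Qed.
Let nu_ge0 i : 0 <= nu_ i. Proof. exact: fine_ge0. Qed.

(** The density on a cell of the coupling with respect to the product measure. Division by 0 gives
    0, which fits: [pi] vanishes wherever a marginal does. *)
Let w (p : I * I) := pi p.1 p.2 / (mu_ p.1 * nu_ p.2).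

Let w_ge0 p : 0 <= w p.
Proof. by rewrite divr_ge0// mulr_ge0. Qed.

Let cell (p : I * I) : set (borel E * borel E)%type :=
  (h @^-1` [set p.1]) `*` (h @^-1` [set p.2]).

Let mcell p : measurable (cell p). Proof. exact: measurableX. Qed.

Let piece (p : I * I) : {measure set (borel E * borel E)%type -> \bar R} :=
  mscale (NngNum (w_ge0 p)) (mrestr (mu \x nu)%E (mcell p)).

(** [msum] runs over natural numbers, so the cells are listed through [enum_val]; [mzero] only fills
    the indices past the last cell. *)
Let ga_measure : {measure set (borel E * borel E)%type -> \bar R} :=
  msum (fun n => if insub n is Some o then piece (enum_val (o : 'I_#|{: I * I}|))
                 else mzero) #|{: I * I}|.

Let ga_measureE A B : measurable A -> measurable B ->
  ga_measure (A `*` B) = (\sum_i \sum_j w (i, j) *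
    (fine (mu (A `&` h @^-1` [set i])) * fine (nu (B `&` h @^-1` [set j]))))%:E.
Proof.
move=> mA mB; rewrite pair_big/= -sumEFin /ga_measure/= /msum.
rewrite [RHS](reindex (enum_val : 'I_#|{: I * I}| -> I * I))/=; last first.
  by apply: onW_bij; exact: enum_val_bij.
apply: eq_bigr => o _; rewrite (valK o : insub (nat_of_ord o) = Some o).
rewrite /piece/= /mscale/= /mrestr -setXI.
have mAi := measurableI _ _ mA (mh (enum_val o).1).
have mBj := measurableI _ _ mB (mh (enum_val o).2).
rewrite product_measure1E// -[X in (_ * (X * _))%E]fineK ?fin_num_measure//.
by rewrite -[X in (_ * (_ * X))%E]fineK ?fin_num_measure.
Qed.

(** On a null cell both sides vanish, the right one by monotonicity and the left one because the
    inverse of 0 is 0. *)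
Let muIE A i : measurable A ->
  fine (mu (A `&` h @^-1` [set i])) * mu_ i / mu_ i = fine (mu (A `&` h @^-1` [set i])).
Proof.
move=> mA; have [m0|m0] := eqVneq (mu_ i) 0; last by rewrite mulfK.
rewrite m0 invr0 mulr0; apply/esym/eqP; rewrite eq_le fine_ge0// andbT -m0.
rewrite fine_le ?fin_num_measure//; first exact: measurableI.
by apply: le_measure; rewrite ?inE//; exact: measurableI.
Qed.

Let nuIE A i : measurable A ->
  fine (nu (A `&` h @^-1` [set i])) * nu_ i / nu_ i = fine (nu (A `&` h @^-1` [set i])).
Proof.
move=> mA; have [m0|m0] := eqVneq (nu_ i) 0; last by rewrite mulfK.
rewrite m0 invr0 mulr0; apply/esym/eqP; rewrite eq_le fine_ge0// andbT -m0.
rewrite fine_le ?fin_num_measure//; first exact: measurableI.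
by apply: le_measure; rewrite ?inE//; exact: measurableI.
Qed.

Let ga_measure_l A : measurable A -> ga_measure (A `*` setT) = mu A.
Proof.
move=> mA; rewrite ga_measureE// -[RHS]fineK ?fin_num_measure//; congr EFin.
rewrite (measure_fin_fibers mu mh mA); apply: eq_bigr => i _.
transitivity (fine (mu (A `&` h @^-1` [set i])) * (\sum_j pi i j) / mu_ i).
  2: by rewrite pi_row muIE.
rewrite mulr_sumr mulr_suml; apply: eq_bigr => j _.
rewrite setTI -/(nu_ j) /w/=.
have [n0|n0] := eqVneq (nu_ j) 0; first by rewrite (pi_col0 i n0) !(mul0r, mulr0).
have [m0|m0] := eqVneq (mu_ i) 0; first by rewrite (pi_row0 j m0) !(mul0r, mulr0).
by field; rewrite n0 m0.
Qed.

Let ga_measure_r A : measurable A -> ga_measure (setT `*` A) = nu A.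
Proof.
move=> mA; rewrite ga_measureE// -[RHS]fineK ?fin_num_measure//; congr EFin.
rewrite (measure_fin_fibers nu mh mA) exchange_big; apply: eq_bigr => j _.
transitivity (fine (nu (A `&` h @^-1` [set j])) * (\sum_i pi i j) / nu_ j).
  2: by rewrite pi_col nuIE.
rewrite mulr_sumr mulr_suml; apply: eq_bigr => i _.
rewrite setTI -/(mu_ i) /w/=.
have [n0|n0] := eqVneq (nu_ j) 0; first by rewrite (pi_col0 i n0) !(mul0r, mulr0).
have [m0|m0] := eqVneq (mu_ i) 0; first by rewrite (pi_row0 j m0) !(mul0r, mulr0).
by field; rewrite n0 m0.
Qed.

(** On each cell the product measure is rescaled to have mass [pi i j]; the row and column sums of
    [pi] then give the marginals on every measurable set. *)
Lemma cell_coupling : exists2 ga : probability (borel E * borel E)%type R,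
  coupling mu nu ga & forall i j,
    fine (ga ((h @^-1` [set i]) `*` (h @^-1` [set j]))) = pi i j.
Proof.
have gaT : ga_measure setT = 1%E.
  by rewrite -setXTT ga_measure_l// probability_setT.
have [ga gaE] := measure_probability gaT.
exists ga => [A mA|i j]; first by rewrite !gaE ga_measure_l// ga_measure_r.
rewrite gaE ga_measureE//= (bigD1 i)//= (bigD1 j)//= !setIid -/(mu_ i) -/(nu_ j).
have I0 (i' k : I) : k != i' -> h @^-1` [set i'] `&` h @^-1` [set k] = set0.
  move=> ki; rewrite -subset0 => x [/= hx hx'].
  by move: ki; rewrite -hx -hx' eqxx.
rewrite big1 => [|k kj]; last by rewrite (I0 _ _ kj) measure0 fine0 !mulr0.
rewrite big1 => [|k ki]; last first.
  by rewrite big1// => l _; rewrite (I0 _ _ ki) measure0 mul0r mulr0.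
rewrite !addr0 /w/=.
have [n0|n0] := eqVneq (nu_ j) 0; first by rewrite (pi_col0 i n0) !(mul0r, mulr0).
have [m0|m0] := eqVneq (mu_ i) 0; first by rewrite (pi_row0 j m0) !(mul0r, mulr0).
by field; rewrite n0 m0.
Qed.

End cell_coupling.

(** * Interpretation of formulas *)

Lemma borel_measurable_continuous (R : realType) (E : ptopologicalType)
    (f : E -> R) : continuous f -> measurable_fun [set: borel E] f.
Proof.
move=> /continuousP cf; apply: (measurability _ (RGenOpens.measurableE R)).
move=> _ [_ [a [b ->] <-]]; rewrite setTI; apply: borel_open.
exact/cf/interval_open.
Qed.

Lemma i01_rat_approx (R : realType) (a eps : R) : 0 <= a <= 1 -> 0 < eps ->
  exists q : {i01 rat}, `|ratr q%:num - a| <= eps.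
Proof.
move=> /andP[a0 a1] e0.
have : Num.max 0 (a - eps) < Num.min 1 (a + eps).
  by rewrite gt_max !lt_min ltr01/=; apply/and3P; split; lra.
move=> /rat_in_itvoo[q]; rewrite in_itv/= gt_max lt_min.
move=> /andP[/andP[q0 aq] /andP[q1 qa]].
have ratr1 : ratr 1 = 1 :> R by rewrite rmorph1.
move: q0 q1; rewrite ltr0q -ratr1 ltr_rat => /ltW q0 /ltW q1.
exists (Itv01 q0 q1) => /=; rewrite ler_norml; apply/andP; split; lra.
Qed.

Lemma powR_le1 (R : realType) (a r : R) : 0 < a <= 1 -> 0 <= r -> a `^ r <= 1.
Proof.
move=> /andP[a0 a1] r0; rewrite /powR gt_eqF// expR_le1 mulr_ge0_le0//.
exact: ln_le0.
Qed.

Section logic.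
Context {R : realType} {E : ptopologicalType} (X : CTMP R E) (c : R).
Hypotheses (c_gt0 : 0 < c) (c_lt1 : c < 1).
Hypothesis E_polish : polish_space R E.

Local Notation ev := (interp X c).

(** Packages a value of the kernel as a [probability], the type over which couplings and bounded
    integrals are treated here. *)
Definition kernel_probability t x : {P : probability (borel E) R |
  forall S, P S = kernel_at X t x S}.
Proof.
by apply/cid/measure_probability; exact: prob_kernel.
Qed.

Lemma Rintegral_kernel t x (f : E -> R) :
  \int[kernel_at X t x]_y f y = \int[sval (kernel_probability t x)]_y f y.
Proof.
congr fine; apply: eq_measure_integral => S mS _.
by have := svalP (kernel_probability t x) S.
Qed.

Lemma ratr_i01 (q : {i01 rat}) : 0 <= (ratr q%:num : R) <= 1.
Proof. 
have ratr1 : ratr 1 = 1 :> R by rewrite rmorph1.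
by rewrite ler0q ge0/= -ratr1 ler_rat le1.
 Qed.

Lemma Rintegral_prob01 d (T : measurableType d) (P : probability T R)
    (f : T -> R) : measurable_fun setT f -> (forall x, 0 <= f x <= 1) ->
  0 <= \int[P]_x f x <= 1.
Proof.
move=> mf f01; rewrite Rintegral_ge0 => [|x _]; last by have /andP[] := f01 x.
rewrite -[leRHS](Rintegral_prob_cst P) le_Rintegral//.
- apply: (@bounded_integrable _ _ _ _ _ 1) => // x.
  by have /andP[f0 f1] := f01 x; rewrite ger0_norm.
- exact: finite_measure_integrable_cst.
- by move=> x _; have /andP[] := f01 x.
Qed.

Lemma interp_continuous_unit f :
  continuous (ev f) /\ forall x, 0 <= ev f x <= 1.
Proof.
elim: f => [q| |f [cf f01] g [cg g01]|f [cf f01]|f [cf f01] q|t f [cf f01]] /=.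
- by split => [|x]; [exact: cst_continuous|exact: ratr_i01].
- by split; [exact: obs_continuous|exact: obs_unit_interval].
- split => x; first by apply: continuous_min; [exact: cf|exact: cg].
  have /andP[f0 f1] := f01 x; have /andP[g0 g1] := g01 x.
  by rewrite le_min f0 g0 ge_min f1.
- split => x; first by apply: cvgB; [exact: cvg_cst|exact: cf].
  by have /andP[f0 f1] := f01 x; rewrite subr_ge0 f1 gerBl.
- split => x.
    apply: (@continuous_max _ _ (fun=> 0) (fun x => ev f x - _)).
      exact: cst_continuous.
    by apply: cvgB; [exact: cf|exact: cvg_cst].
  have /andP[f0 f1] := f01 x; have /andP[q0 q1] := ratr_i01 q.
  by rewrite le_max lexx ge_max ler01/= lerBlDr (le_trans f1)// lerDl.
- split; last first.
    move=> x; rewrite Rintegral_kernel.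
    have /andP[i0 i1] : 0 <= \int[sval (kernel_probability (time_of_rat R t) x)]_y
        ev f y <= 1.
      by apply: Rintegral_prob01 => //; exact: borel_measurable_continuous.
    have ct1 : c `^ (ratr t%:num) <= 1.
      by apply: powR_le1; [rewrite c_gt0 ltW|rewrite ler0q].
    by rewrite mulr_ge0 ?powR_ge0//= mulr_ile1 ?powR_ge0.
  (* Weak continuity of the kernel speaks of sequences only; metrizability upgrades it to continuity
     of the modal formula. *)
  have [_ [d [d_metric d_topology _]]] := E_polish.
  apply: (metrizable_sequential_continuous d_topology) => u x ux.
  apply: cvgM; first exact: cvg_cst.
  apply: (kernel_at_weak_continuous ux) => //.
  by exists 1 => y; have /andP[f0 f1] := f01 y; rewrite ger0_norm.
Qed.

End logic.

(** * Distances given by finitely many formulas, and interpolation by formulas *)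

Lemma minr_dist_le (R : realDomainType) (a b a' b' r : R) :
  `|a - a'| <= r -> `|b - b'| <= r -> `|Num.min a b - Num.min a' b'| <= r.
Proof.
rewrite !ler_norml => /andP[? ?] /andP[? ?].
by case: (leP a b) => ?; case: (leP a' b') => ?; apply/andP; split; lra.
Qed.

Lemma maxr_dist_le (R : realDomainType) (a b a' b' r : R) :
  `|a - a'| <= r -> `|b - b'| <= r -> `|Num.max a b - Num.max a' b'| <= r.
Proof.
rewrite !ler_norml => /andP[? ?] /andP[? ?].
by case: (leP a b) => ?; case: (leP a' b') => ?; apply/andP; split; lra.
Qed.

Section formula_distance.
Context {R : realType} {E : ptopologicalType} (X : CTMP R E) (c : R).
Hypotheses (c_gt0 : 0 < c) (c_lt1 : c < 1).
Hypothesis E_polish : polish_space R E.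
Variable e : nat -> formula.

Local Notation ev := (interp X c).

Let ev_continuous f : continuous (ev f).
Proof. by have [] := interp_continuous_unit X c_gt0 c_lt1 E_polish f. Qed.

Let ev01 f x : 0 <= ev f x <= 1.
Proof. by have [] := interp_continuous_unit X c_gt0 c_lt1 E_polish f. Qed.

Let ev_measurable f : measurable_fun [set: borel E] (ev f).
Proof. exact: borel_measurable_continuous. Qed.

(** The pseudometric [D_n] of the overview, for the enumeration [e]. *)
Fixpoint fdist n (x y : E) : R :=
  if n is k.+1 then Num.max (fdist k x y) `|ev (e k) x - ev (e k) y| else 0.

Lemma fdist_ge0 n x y : 0 <= fdist n x y.
Proof. by elim: n => //= n h; rewrite le_max h. Qed.

Lemma fdist_lub n x y r : 0 <= r ->
  (forall k, (k < n)%N -> `|ev (e k) x - ev (e k) y| <= r) -> fdist n x y <= r.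
Proof.
move=> r0; elim: n => [|n IH] H; first by [].
by rewrite /= ge_max H// IH// => k kn; exact/H/ltnW.
Qed.

Lemma fdist_ub n k x y : (k < n)%N -> `|ev (e k) x - ev (e k) y| <= fdist n x y.
Proof.
elim: n => // n IH; rewrite ltnS leq_eqVlt /= le_max.
by move=> /orP[/eqP ->|/IH ->//]; rewrite lexx orbT.
Qed.

Lemma fdist_homo m n x y : (m <= n)%N -> fdist m x y <= fdist n x y.
Proof.
move=> mn; apply: fdist_lub; first exact: fdist_ge0.
by move=> k km; apply: fdist_ub; exact: leq_trans mn.
Qed.

Lemma ev_dist_le1 f x y : `|ev f x - ev f y| <= 1.
Proof.
have /andP[? ?] := ev01 f x; have /andP[? ?] := ev01 f y.
by rewrite ler_norml; apply/andP; split; lra.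
Qed.

Lemma fdist_le1 n x y : fdist n x y <= 1.
Proof. by apply: fdist_lub => // k _; exact: ev_dist_le1. Qed.

Lemma fdistxx n x : fdist n x x = 0.
Proof.
apply/eqP; rewrite eq_le fdist_ge0 andbT; apply: fdist_lub => // k _.
by rewrite subrr normr0.
Qed.

Lemma fdistC n x y : fdist n x y = fdist n y x.
Proof. by elim: n => //= n ->; rewrite distrC. Qed.

Lemma fdist_triangle n x y z : fdist n x z <= fdist n x y + fdist n y z.
Proof.
apply: fdist_lub; first by rewrite addr_ge0// fdist_ge0.
move=> k kn; apply: (le_trans (ler_distD (ev (e k) y) _ _)).
by apply: lerD; exact: fdist_ub.
Qed.

Lemma fdist_attained n x y r : r <= fdist n x y ->
  r <= 0 \/ exists2 k, (k < n)%N & r <= `|ev (e k) x - ev (e k) y|.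
Proof.
elim: n => [|n IH]; first by left.
rewrite /= le_max => /orP[/IH[|[k kn ?]]|]; first by left.
  by right; exists k => //; exact: ltnW.
by right; exists n.
Qed.

Lemma fdist_measurable n :
  measurable_fun [set: (borel E * borel E)%type] (fun z => fdist n z.1 z.2).
Proof.
elim: n => [|n IH].
  rewrite (_ : (fun _ => _) = fun=> 0); first exact: measurable_cst.
  exact/funext.
rewrite (_ : (fun z => _) = (fun z => fdist n z.1 z.2) \max
    (fun z => `|ev (e n) z.1 - ev (e n) z.2|)); last first.
  exact/funext.
apply: measurable_maxr => //; apply: measurableT_comp => //.
apply: measurable_funB.
  exact: (measurableT_comp (@ev_measurable (e n)) measurable_fst).
exact: (measurableT_comp (@ev_measurable (e n)) measurable_snd).
Qed.

Definition fdist_lipschitz n f :=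
  forall x y, `|ev f x - ev f y| <= fdist n x y.

Lemma lipschitz_const n q : fdist_lipschitz n (FConst q).
Proof. by move=> x y /=; rewrite subrr normr0 fdist_ge0. Qed.

Lemma lipschitz_neg n f : fdist_lipschitz n f -> fdist_lipschitz n (FNeg f).
Proof.
move=> lf x y /=; have := lf x y; rewrite distrC; congr (`|_| <= _); ring.
Qed.

Lemma lipschitz_sub n f q : fdist_lipschitz n f -> fdist_lipschitz n (FSub f q).
Proof.
move=> lf x y /=; apply: maxr_dist_le; first by rewrite subrr normr0 fdist_ge0.
by have := lf x y; rewrite opprB addrA subrK.
Qed.

Lemma lipschitz_min n f g : fdist_lipschitz n f -> fdist_lipschitz n g ->
  fdist_lipschitz n (FMin f g).
Proof. by move=> lf lg x y /=; apply: minr_dist_le; [exact: lf|exact: lg]. Qed.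

(** [M] is an iterated [FMin] that ends in the constant 1, the value of the empty minimum; hence the
    condition [r <= 1]. *)
Lemma formula_lattice_min n (I : finType) (G : I -> formula) :
  (forall i, fdist_lipschitz n (G i)) ->
  exists M, [/\ fdist_lipschitz n M, forall x i, ev M x <= ev (G i) x &
    forall x r, r <= 1 -> (forall i, r <= ev (G i) x) -> r <= ev M x].
Proof.
move=> lG.
suff H (s : seq I) : exists M, [/\ fdist_lipschitz n M,
    forall x i, i \in s -> ev M x <= ev (G i) x &
    forall x r, r <= 1 -> (forall i, i \in s -> r <= ev (G i) x) -> r <= ev M x].
  have [M [lM Ml Mr]] := H (enum I); exists M; split => // [x i|x r r1 rG].
    by apply: Ml; rewrite mem_enum.
  exact: Mr.
elim: s => [|i s [M [lM Ml Mr]]].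
  exists (FConst 1%:i01); split => //; first exact: lipschitz_const.
  by move=> x r r1 _ /=; rewrite rmorph1.
exists (FMin (G i) M); split; first exact: lipschitz_min.
  move=> x j; rewrite inE => /orP[/eqP ->|/(Ml x) h] /=; rewrite ge_min ?lexx//.
  by rewrite h orbT.
move=> x r r1 rG /=; rewrite le_min rG ?mem_head//=; apply: Mr => // j js.
by apply: rG; rewrite inE js orbT.
Qed.

(** De Morgan dual of the minimum; the empty maximum is 0, hence the condition [0 <= r]. *)
Lemma formula_lattice_max n (I : finType) (G : I -> formula) :
  (forall i, fdist_lipschitz n (G i)) ->
  exists M, [/\ fdist_lipschitz n M, forall x i, ev (G i) x <= ev M x &
    forall x r, 0 <= r -> (forall i, ev (G i) x <= r) -> ev M x <= r].
Proof.
move=> lG; have lNG i : fdist_lipschitz n (FNeg (G i)) by exact: lipschitz_neg.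
have [M [lM Ml Mr]] := formula_lattice_min lNG.
exists (FNeg M); split; first exact: lipschitz_neg.
  by move=> x i /=; have /= := Ml x i; lra.
move=> x r r0 rG /=; have : 1 - r <= ev M x.
  by apply: Mr => [|i /=]; [lra|have := rG i; lra].
lra.
Qed.

(** Some [e k] or its negation drops by at least [a - b] from [x] to [y]. Shifting it to about 0 at
    [y], cutting it at about [a - b] and lifting it by about [b] gives the required values; rational
    constants cause the error. *)
Lemma formula_two_points n x y (a b eps : R) : 0 < eps -> 0 <= b <= a -> a <= 1 ->
  a - b <= fdist n x y ->
  exists f, [/\ fdist_lipschitz n f, `|ev f x - a| <= eps & `|ev f y - b| <= eps].
Proof.
move=> eps0 /andP[b0 ba] a1 /fdist_attained[ab|[k kn abk]].
  have ab' : a = b by lra.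
  have [q hq] : exists q : {i01 rat}, `|ratr q%:num - a| <= eps.
    by apply: i01_rat_approx => //; apply/andP; split; lra.
  exists (FConst q); split => //=; first exact: lipschitz_const.
  by rewrite -ab'.
have lk : fdist_lipschitz n (e k) by move=> u v; exact: fdist_ub.
have [g lg abg] : exists2 g, fdist_lipschitz n g & a - b <= ev g x - ev g y.
  have [h|h] := leP (ev (e k) y) (ev (e k) x).
    by exists (e k) => //; move: abk; rewrite ger0_norm// subr_ge0.
  exists (FNeg (e k)); first exact: lipschitz_neg.
  by move: abk; rewrite ltr0_norm ?subr_lt0//=; lra.
have e20 : 0 < eps / 2 by rewrite divr_gt0.
have [q1 hq1] := i01_rat_approx (ev01 g y) e20.
have [q2 hq2] : exists q : {i01 rat}, `|ratr q%:num - (a - b)| <= eps / 2.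
  by apply: i01_rat_approx => //; apply/andP; split; lra.
have [q3 hq3] : exists q : {i01 rat}, `|ratr q%:num - b| <= eps / 2.
  by apply: i01_rat_approx => //; apply/andP; split; lra.
(* Addition of [q3], capped at 1, is written as [1 - ((1 - u) - q3)] with truncated subtraction. *)
exists (FNeg (FSub (FNeg (FMin (FSub g q1) (FConst q2))) q3)); split.
- apply/lipschitz_neg/lipschitz_sub/lipschitz_neg/lipschitz_min.
    exact: lipschitz_sub.
  exact: lipschitz_const.
- move: hq1 hq2 hq3 => /=; rewrite !ler_norml.
  move=> /andP[? ?] /andP[? ?] /andP[? ?].
  have /andP[? ?] := @ratr_i01 R q2.
  case: (leP 0 (ev g x - _)) => ?; case: (leP _ (ratr q2%:num)) => ?;
  case: (leP 0 (1 - _ - ratr q3%:num)) => ?; apply/andP; split; lra.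
- move: hq1 hq2 hq3 => /=; rewrite !ler_norml.
  move=> /andP[? ?] /andP[? ?] /andP[? ?].
  have /andP[? ?] := @ratr_i01 R q2.
  case: (leP 0 (ev g y - _)) => ?; case: (leP _ (ratr q2%:num)) => ?;
  case: (leP 0 (1 - _ - ratr q3%:num)) => ?; apply/andP; split; lra.
Qed.

(** As in Stone-Weierstrass: let [G (i, j)] fit [k] at [x i] and [x j], and take the maximum over
    [i] of the minima over [j]. At [x i] the [i]-th minimum gives the lower bound, and each [j]-th
    minimum is at most [G (j, i)], which gives the upper bound. *)
Lemma formula_interpolation n (I : finType) (x : I -> E) (k : I -> R) (eps : R) :
  0 < eps -> (forall i, 0 <= k i <= 1) ->
  (forall i j, k i - k j <= fdist n (x i) (x j)) ->
  exists2 f, fdist_lipschitz n f & forall i, `|ev f (x i) - k i| <= eps.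
Proof.
move=> eps0 k01 kL.
have /choice[G hG] (p : I * I) : exists f, [/\ fdist_lipschitz n f,
    `|ev f (x p.1) - k p.1| <= eps & `|ev f (x p.2) - k p.2| <= eps].
  case: p => i j /=.
  have /andP[? ?] := k01 i; have /andP[? ?] := k01 j.
  have [kij|kij] := leP (k j) (k i).
    by apply: formula_two_points => //; apply/andP; split.
  have [|||f [? ? ?]] := @formula_two_points n (x j) (x i) (k j) (k i) eps eps0.
  - by apply/andP; split => //; exact: ltW.
  - by [].
  - exact: kL.
  - by exists f.
have /choice[M hM] i := @formula_lattice_min n I (fun j => G (i, j))
  (fun j => let: And3 h _ _ := hG (i, j) in h).
have [F [lF Fl Fr]] := @formula_lattice_max n I M
  (fun i => let: And3 h _ _ := hM i in h).
exists F => // i; rewrite ler_norml; apply/andP; split.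
  suff : k i - eps <= ev (M i) (x i) by have := Fl (x i) i; lra.
  have [_ _ Mr] := hM i; apply: Mr; first by have /andP[? ?] := k01 i; lra.
  by move=> j; have [_ + _] := hG (i, j); rewrite ler_norml => /andP[/= ? _]; lra.
suff : ev F (x i) <= k i + eps by lra.
apply: Fr => [|j]; first by have /andP[? ?] := k01 i; lra.
have [_ Ml _] := hM j; apply: (le_trans (Ml _ i)).
by have [_ _ ] := hG (j, i); rewrite ler_norml => /andP[/= _ ?]; lra.
Qed.

End formula_distance.

(** * Cells of small diameter and couplings for [fdist] *)

Section formula_coupling.
Context {R : realType} {E : ptopologicalType} (X : CTMP R E) (c : R).
Hypotheses (c_gt0 : 0 < c) (c_lt1 : c < 1).
Hypothesis E_polish : polish_space R E.
Variable e : nat -> formula.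

Local Notation ev := (interp X c).
Local Notation fdist := (fdist X c e).

Let ev_continuous f : continuous (ev f).
Proof. by have [] := interp_continuous_unit X c_gt0 c_lt1 E_polish f. Qed.

Let ev01 f x : 0 <= ev f x <= 1.
Proof. by have [] := interp_continuous_unit X c_gt0 c_lt1 E_polish f. Qed.

Let ev_measurable f : measurable_fun [set: borel E] (ev f).
Proof. exact: borel_measurable_continuous. Qed.

Let ev_norm_le1 f x : `|ev f x| <= 1.
Proof. by have /andP[? ?] := ev01 f x; rewrite ger0_norm. Qed.

Let fdist_measurable n :
  measurable_fun [set: (borel E * borel E)%type] (fun z => fdist n z.1 z.2).
Proof. exact: fdist_measurable. Qed.

Let fdist_norm_le1 n x y : `|fdist n x y| <= 1.
Proof. by rewrite ger0_norm ?fdist_ge0// fdist_le1. Qed.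

(** A cell records which thresholds [p / N] each of the first [n] formulas reaches. Two points of
    one cell differ by at most [1 / N] on all of them. *)
Lemma fdist_cells n (eps : R) : 0 < eps ->
  exists (I : finType) (h : E -> I) (r : I -> E),
    (forall i, measurable (h @^-1` [set i] : set (borel E))) /\
    forall x, fdist n x (r (h x)) <= eps.
Proof.
move=> eps0; pose N := (Num.bound eps^-1).+1.
have N0 : 0 < N%:R :> R by rewrite ltr0n.
have Neps : N%:R^-1 <= eps.
  rewrite invf_ple ?posrE// (le_trans (ltW (archi_boundP _)))//.
    by rewrite invr_ge0 ltW.
  by rewrite ler_nat.
pose I : finType := {ffun 'I_n * 'I_N.+1 -> bool}.
pose h x : I := [ffun p : 'I_n * 'I_N.+1 => p.2%:R / N%:R <= ev (e p.1) x].
have hd k x y : (k < n)%N -> h x = h y -> ev (e k) x - ev (e k) y <= N%:R^-1.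
  move=> kn hxy; have /andP[f0 f1] := ev01 (e k) x.
  have Nf0 : 0 <= N%:R * ev (e k) x by rewrite mulr_ge0// ltW.
  (* [j / N] is the last threshold reached at [x]. It is also reached at [y], while
     [ev (e k) x < (j + 1) / N]. *)
  pose j := Num.truncn (N%:R * ev (e k) x).
  have /andP[jle jgt] := Num.Theory.truncn_itv Nf0; rewrite -/j in jle jgt.
  have jN : (j < N.+1)%N.
    by rewrite ltnS -(ler_nat R) (le_trans jle)// ler_piMr// ltW.
  have := congr1 (fun g : I => g (Ordinal kn, Ordinal jN)) hxy.
  rewrite !ffunE/= ler_pdivrMr// mulrC jle => /esym.
  rewrite ler_pdivrMr// => jy.
  rewrite -(ler_pM2l N0) divff ?gt_eqF// mulrBr lerBlDr (le_trans (ltW jgt))//.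
  by rewrite -natr1 addrC lerD2l mulrC.
(* An empty cell gets the default [point]; its preimage has mass 0. *)
pose r (i : I) := xget point [set x | h x = i].
exists I, h, r; split.
- move=> i.
  have -> : h @^-1` [set i] = \bigcap_(p in [set: 'I_n * 'I_N.+1])
      [set x | (p.2%:R / N%:R <= ev (e p.1) x) = i p].
    apply/seteqP; split => [x /= <- p _ /=|x hx /=]; first by rewrite ffunE.
    by apply/ffunP => p; rewrite ffunE; exact: hx.
  apply: fin_bigcap_measurable => [|p _]; first exact: finite_finset.
  case: (i p).
    rewrite (_ : [set x | _] = ev (e p.1) @^-1` [set y | p.2%:R / N%:R <= y]) //.
    apply: borel_closed; apply: closed_comp => [x _|]; first exact: ev_continuous.
    exact: closed_ge.
  rewrite (_ : [set x | _] = ev (e p.1) @^-1` [set y | y < p.2%:R / N%:R]).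
    apply: borel_open; apply: open_comp => [x _|]; first exact: ev_continuous.
    exact: open_lt.
  by apply/seteqP; split => x /=; rewrite ltNge; [move=> ->|move/negbTE].
move=> x; have hr : h (r (h x)) = h x.
  by apply: (@xgetPex _ point [set y | h y = h x]); exists x.
apply: le_trans Neps; apply: fdist_lub; first by rewrite invr_ge0 ltW.
move=> k kn; have := hd k _ _ kn hr; have := hd k _ _ kn (esym hr).
by rewrite ler_norml => ? ?; apply/andP; split; lra.
Qed.

Variables mu nu : probability (borel E) R.

Section cells.
Context (n : nat) (eps : R) (I : finType) (h : E -> I) (r : I -> E).
Hypotheses (mh : forall i, measurable (h @^-1` [set i] : set (borel E)))
  (hr : forall x, fdist n x (r (h x)) <= eps).

(** Moving each coordinate to the representative of its cell costs [eps]. The bound is uniform in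
    [ga], so it serves both for one coupling and along a limit of couplings. *)
Lemma Rintegral_fdist_cells (ga : probability (borel E * borel E)%type R) :
  `|\int[ga]_z fdist n z.1 z.2 - \sum_i \sum_j fdist n (r i) (r j) *
      fine (ga ((h @^-1` [set i]) `*` (h @^-1` [set j])))| <= eps + eps.
Proof.
pose h2 (z : borel E * borel E) := (h z.1, h z.2).
have h2E p : h2 @^-1` [set p] = (h @^-1` [set p.1]) `*` (h @^-1` [set p.2]).
  case: p => i j; apply/seteqP; split => -[x y] /=; first by case.
  by move=> [/= hx hy]; rewrite /h2 /= hx hy.
have mh2 p : measurable (h2 @^-1` [set p]) by rewrite h2E; exact: measurableX.
have := Rintegral_fin_valued ga mh2 (fun p => fdist n (r p.1) (r p.2)).
under [X in _ = X -> _]eq_bigr do rewrite h2E.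
rewrite pair_big /= => <-.
apply: (@Rintegral_dist_le _ _ _ _ _ _ 1 1) => //.
  exact: (fin_valued_measurable mh2 (fun p => fdist n (r p.1) (r p.2))).
move=> [x y] /=; rewrite ler_norml.
have := fdist_triangle X c e n x (r (h x)) y.
have := fdist_triangle X c e n (r (h x)) (r (h y)) y.
have := fdist_triangle X c e n (r (h x)) x (r (h y)).
have := fdist_triangle X c e n x y (r (h y)).
have := hr x; have := hr y; rewrite (fdistC X c e n (r (h x)) x).
rewrite (fdistC X c e n (r (h y)) y).
by move=> *; apply/andP; split; lra.
Qed.

End cells.

Variable L : R.
Hypothesis formula_gap : forall f,
  \int[mu]_x ev f x - \int[nu]_x ev f x <= L.

(** Transport between cell masses is a finite problem. Its dual functions are approximated by
    formulas, for which [formula_gap] gives the bound; the optimal plan is then spread over the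
    cells. *)
Lemma finite_fdist_coupling n (eps : R) : 0 < eps ->
  exists2 ga : probability (borel E * borel E)%type R, coupling mu nu ga &
    \int[ga]_z fdist n z.1 z.2 <= L + eps.
Proof.
move=> eps0; have e8 : 0 < eps / 8 by rewrite divr_gt0.
have [I [h [r [mh hr]]]] := fdist_cells n e8.
pose mu_ i := fine (mu (h @^-1` [set i])); pose nu_ i := fine (nu (h @^-1` [set i])).
have sum1 (m : probability (borel E) R) : \sum_i fine (m (h @^-1` [set i])) = 1.
  have := measure_fin_fibers m mh measurableT; rewrite probability_setT => /esym.
  by under eq_bigr do rewrite setTI.
have [|||||| |pi [pi0 pir pic piL]] := @finite_kantorovich R I
    (fun i j => fdist n (r i) (r j)) mu_ nu_ (L + eps / 2).
- by move=> i; exact: fdistxx.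
- by move=> i j; exact: fdistC.
- by move=> i j k; exact: fdist_triangle.
- by move=> i; exact: fine_ge0.
- by move=> i; exact: fine_ge0.
- by rewrite !sum1.
(* Subtracting the minimum puts [k] into [[0, 1]], since [fdist] is at most 1; the shift cancels
   because both measures have mass 1. *)
- move=> k kL; pose i0 := [arg min_(i < h point) k i]%O.
  have ki0 i : k i0 <= k i.
    by rewrite /i0; case: arg_minP => // j _; exact.
  pose k' i := k i - k i0.
  have k'01 i : 0 <= k' i <= 1.
    by rewrite /k' subr_ge0 ki0/= (le_trans (kL _ _))// fdist_le1.
  have k'L i j : k' i - k' j <= fdist n (r i) (r j).
    by rewrite /k' opprB addrA subrK.
  have [f lf fk] := formula_interpolation c_gt0 c_lt1 E_polish e8 k'01 k'L.
  (* Cell diameter and interpolation cost [eps / 8] each. The two measures together lose [eps / 2],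
     the slack given to the finite problem. *)
  have E1 (m : probability (borel E) R) :
      `|\int[m]_x k' (h x) - \int[m]_x ev f x| <= eps / 4.
    apply: (@Rintegral_dist_le _ _ _ _ _ _ 1 1) => //.
    + exact: (fin_valued_measurable mh k').
    + by move=> x; have /andP[? ?] := k'01 (h x); rewrite ger0_norm.
    + move=> x; have := fk (h x); have := lf x (r (h x)); have := hr x.
      rewrite !ler_norml => ? /andP[? ?] /andP[? ?].
      by apply/andP; split; lra.
  have -> : \sum_i k i * (mu_ i - nu_ i) =
      \int[mu]_x k' (h x) - \int[nu]_x k' (h x).
    rewrite !(Rintegral_fin_valued _ mh) -sumrB.
    have -> : \sum_i k i * (mu_ i - nu_ i) = \sum_i k i * (mu_ i - nu_ i) -
        k i0 * (\sum_i mu_ i - \sum_i nu_ i).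
      by rewrite !sum1 subrr mulr0 subr0.
    rewrite -sumrB mulr_sumr -sumrB; apply: eq_bigr => i _.
    by rewrite /k' /mu_ /nu_; ring.
  have := E1 mu; have := E1 nu; have := formula_gap f.
  by rewrite !ler_norml => ? /andP[? ?] /andP[? ?]; lra.
have [ga cga gaE] := cell_coupling mh pi0 pir pic.
exists ga => //.
have := Rintegral_fdist_cells mh hr ga.
under eq_bigr do under eq_bigr do rewrite gaE mulrC.
by rewrite ler_norml => /andP[_ ?]; lra.
Qed.

End formula_coupling.

(** * Couplings for the logical distance *)

(** Generic trees over [rat] are countable, so an injective code makes the set of formulas
    countable. *)
Fixpoint formula_code (f : formula) : GenTree.tree rat :=
  match f with
  | FConst q => GenTree.Node 0 [:: GenTree.Leaf q%:num]
  | FObs => GenTree.Node 1 [::]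
  | FMin f1 f2 => GenTree.Node 2 [:: formula_code f1; formula_code f2]
  | FNeg f => GenTree.Node 3 [:: formula_code f]
  | FSub f q => GenTree.Node 4 [:: formula_code f; GenTree.Leaf q%:num]
  | FDia t f => GenTree.Node 5 [:: GenTree.Leaf t%:num; formula_code f]
  end.

Lemma formula_code_inj : injective formula_code.
Proof.
elim=> [q| |f IHf g IHg|f IHf|f IHf q|t f IHf] [q'| |f' g'|f'|f' q'|t' f'] //=.
- by move=> [/val_inj ->].
- by move=> [/IHf -> /IHg ->].
- by move=> [/IHf ->].
- by move=> [/IHf -> /val_inj ->].
- by move=> [/val_inj -> /IHf ->].
Qed.

Lemma formula_enumeration : exists e : nat -> formula, forall f, exists n, e n = f.
Proof.
have : countable [set: formula].
  apply/countable_injP; exists (choice.pickle \o formula_code) => f g _ _.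
  by move=> /(pcan_inj choice.pickleK)/formula_code_inj.
move=> /pfcard_geP[F0|[e]]; first by have : [set: formula] FObs by []; rewrite F0.
exists e => f; have [n _ <-] := @surj _ _ _ _ e f I.
by exists n.
Qed.

Section lambda_coupling.
Context {R : realType} {E : ptopologicalType} (X : CTMP R E) (c : R).
Hypotheses (c_gt0 : 0 < c) (c_lt1 : c < 1).
Hypotheses (E_locally_compact : locally_compact [set: E])
  (E_hausdorff : hausdorff_space E)
  (E_second_countable : @second_countable E)
  (E_polish : polish_space R E).

Local Notation ev := (interp X c).
Local Notation lam := (lambda X c).

Let lam_has_sup x y : has_sup [set `|f x - f y| | f in Lambda X c].
Proof.
split; first by exists `|ev FObs x - ev FObs y|; exists (ev FObs) => //; exists FObs.
by exists 1 => _ [_ [f _ <-] <-]; exact: ev_dist_le1.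
Qed.

Lemma lambda_ub f x y : `|ev f x - ev f y| <= lam x y.
Proof.
by apply: sup_upper_bound => //; exists (ev f) => //; exists f.
Qed.

Lemma lambda_lub x y r : (forall f, `|ev f x - ev f y| <= r) -> lam x y <= r.
Proof.
move=> H; apply: ge_sup; first by have [] := lam_has_sup x y.
by move=> _ [_ [f _ <-] <-].
Qed.

Lemma lambda_ge0 x y : 0 <= lam x y.
Proof. exact: le_trans (lambda_ub FObs x y). Qed.

Lemma lambda_pseudometric1 : pseudometric1 lam.
Proof.
split => [x y|x|x y|x y z].
- by rewrite lambda_ge0 lambda_lub// => f; exact: ev_dist_le1.
- apply/eqP; rewrite eq_le lambda_ge0 andbT; apply: lambda_lub => f.
  by rewrite subrr normr0.
- by apply/eqP; rewrite eq_le; apply/andP; split; apply: lambda_lub => f;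
    rewrite distrC lambda_ub.
- apply: lambda_lub => f; apply: (le_trans (ler_distD (ev f y) _ _)).
  by apply: lerD; exact: lambda_ub.
Qed.

(** A supremum of continuous functions is lower semicontinuous: a formula that exceeds [a] at
    [(x, y)] does so on a neighbourhood. *)
Lemma lambda_lsc : lsc lam.
Proof.
move=> [x y] a /=; rewrite lte_fin => alam.
have [f af] : exists f, a < `|ev f x - ev f y|.
  apply: contrapT => /forallNP H; move: alam; rewrite ltNge => /negP; apply.
  by apply: lambda_lub => f; rewrite leNgt; apply/negP.
have [cf _] := interp_continuous_unit X c_gt0 c_lt1 E_polish f.
have cv : `|ev f z.1 - ev f z.2| @[z --> (x, y)] --> `|ev f x - ev f y|.
  apply: cvg_norm; apply: cvgB.
    by apply: (@cvg_comp _ _ _ fst (ev f)); [exact: cvg_fst|exact: cf].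
  by apply: (@cvg_comp _ _ _ snd (ev f)); [exact: cvg_snd|exact: cf].
exists [set z | a < `|ev f z.1 - ev f z.2|].
  apply: (cv [set r | a < r]); apply: open_nbhs_nbhs; split; last exact: af.
  exact: open_gt.
move=> z /= az; rewrite lte_fin; apply: (lt_le_trans az); exact: lambda_ub.
Qed.

Section enumerated.
Variable e : nat -> formula.
Hypothesis e_surj : forall f, exists n, e n = f.
Local Notation fdist := (fdist X c e).

Lemma fdist_cvg_lambda x y : (fdist n x y)%:E @[n --> \oo] --> (lam x y)%:E.
Proof.
have nd : nondecreasing_seq (fun n => (fdist n x y)%:E).
  by move=> m n mn; rewrite lee_fin fdist_homo.
rewrite (_ : (lam x y)%:E = ereal_sup (range (fun n => (fdist n x y)%:E))).
  exact: ereal_nondecreasing_cvgn.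
apply/eqP; rewrite eq_le; apply/andP; split; last first.
  apply: ge_ereal_sup => _ [n _ <-]; rewrite lee_fin fdist_lub ?lambda_ge0//.
  by move=> k _; exact: lambda_ub.
set s := ereal_sup _.
have sle n : ((fdist n x y)%:E <= s)%E by apply: ereal_sup_ubound; exists n.
have sfin : s \is a fin_num.
  rewrite ge0_fin_numE; last by rewrite (le_trans _ (sle 0%N)).
  rewrite (@le_lt_trans _ _ 1%E) ?ltry//; apply: ge_ereal_sup => _ [n _ <-].
  by rewrite lee_fin fdist_le1.
rewrite -(fineK sfin) lee_fin; apply: lambda_lub => f.
have [n <-] := e_surj f; rewrite -lee_fin fineK//; apply: le_trans (sle n.+1).
by rewrite lee_fin fdist_ub.
Qed.

(** Measurability for the product sigma-algebra comes from the pointwise limit of the [fdist n]. *)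
Lemma lambda_measurable :
  measurable_fun [set: (borel E * borel E)%type] (fun z => (lam z.1 z.2)%:E).
Proof.
apply: (@emeasurable_fun_cvg _ _ _ _
  (fun n (z : borel E * borel E) => (fdist n z.1 z.2)%:E)).
  by move=> n; apply/measurable_EFinP; exact: fdist_measurable.
by move=> z _; exact: fdist_cvg_lambda.
Qed.

Variables (mu nu : probability (borel E) R) (L : R).
Hypothesis formula_gap : forall f, \int[mu]_x ev f x - \int[nu]_x ev f x <= L.

Let fdist_measurable n :
  measurable_fun [set: (borel E * borel E)%type] (fun z => fdist n z.1 z.2).
Proof. exact: fdist_measurable. Qed.

Let fdist_integrable (ga : probability (borel E * borel E)%type R) n :
  ga.-integrable setT (EFin \o (fun z => fdist n z.1 z.2)).
Proof.
apply: (@bounded_integrable _ _ _ _ _ 1) => // z.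
by rewrite ger0_norm ?fdist_ge0// fdist_le1.
Qed.

Lemma fdist_limit_coupling :
  exists2 ga : probability (borel E * borel E)%type R, coupling mu nu ga &
    forall n, \int[ga]_z fdist n z.1 z.2 <= L.
Proof.
have [_ [d [d_metric d_topology _]]] := E_polish.
have /choice[g hg] (n : nat) : exists ga : probability (borel E * borel E)%type R,
    coupling mu nu ga /\ \int[ga]_z fdist n z.1 z.2 <= L + n.+1%:R^-1.
  have n0 : 0 < n.+1%:R^-1 :> R by rewrite invr_gt0.
  have [ga ? ?] := finite_fdist_coupling c_gt0 c_lt1 E_polish e formula_gap n n0.
  by exists ga.
(* An ultrafilter finer than convergence to infinity makes the masses of all rectangles converge at
   once, and it contains every eventual property. *)
have [G [UG Goo]] := @ultraFilterLemma nat \oo _.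
have PG : ProperFilter G by exact: ultra_proper.
have regular := @borel_regular R E d d_metric d_topology E_locally_compact
  E_hausdorff E_second_countable.
have [ga cga gaG] := coupling_limit regular E_hausdorff UG (fun n => (hg n).1).
exists ga => // n; apply/ler_addgt0Pr => eps eps0; move: (eps : R) eps0 => {}eps eps0.
have e8 : 0 < eps / 8 by rewrite divr_gt0.
have [I [h [r [mh hr]]]] := fdist_cells X c_gt0 c_lt1 E_polish e n e8.
(* Only masses of rectangles are known to converge, so the integral of [fdist n] is replaced by a
   finite combination of them. *)
pose S (p : probability (borel E * borel E)%type R) := \sum_i \sum_j
  fdist n (r i) (r j) * fine (p ((h @^-1` [set i]) `*` (h @^-1` [set j]))).
have Sint (p : probability (borel E * borel E)%type R) :
    `|\int[p]_z fdist n z.1 z.2 - S p| <= eps / 8 + eps / 8.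
  exact: Rintegral_fdist_cells.
have ScvG : S (g m) @[m --> G] --> S ga.
  apply: cvgr_sum => i; apply: cvgr_sum => j.
  by apply: cvgM; [exact: cvg_cst|exact: gaG].
(* For [m >= n] the bound on [fdist m] also bounds [fdist n]. The cells cost [eps / 4] and
   [1 / (m + 1)] at most [eps / 8]. *)
have Sga : S ga <= L + eps / 2.
  apply: (cvgr_to_le ScvG).
  have [N hN] : exists N : nat, N.+1%:R^-1 <= eps / 8.
    exists (Num.bound (eps / 8)^-1); rewrite invf_ple ?posrE//.
    rewrite (le_trans (ltW (archi_boundP _))) ?ler_nat//.
    by rewrite invr_ge0 ltW.
  apply: Goo; exists (maxn n N) => // m /=; rewrite geq_max => /andP[nm Nm].
  have := Sint (g m); rewrite ler_norml => /andP[Sm _].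
  have gm := (hg m).2.
  have : \int[g m]_z fdist n z.1 z.2 <= \int[g m]_z fdist m z.1 z.2.
    apply: le_Rintegral => [//|||z _].
    - exact: fdist_integrable.
    - exact: fdist_integrable.
    - exact: fdist_homo.
  have : m.+1%:R^-1 <= N.+1%:R^-1 :> R by rewrite lef_pV2 ?posrE// ler_nat.
  move=> /le_trans/(_ hN) h1 /le_trans/(_ gm) h2; move: Sm h1 h2.
  move: (S (g m)) (\int[g m]_z fdist n z.1 z.2) (m.+1%:R^-1) => a b k.
  lra.
have := Sint ga; rewrite ler_norml => /andP[_]; move: Sga.
by move: (S ga) (\int[ga]_z fdist n z.1 z.2) => a b; lra.
Qed.

Lemma lambda_limit_coupling :
  exists2 ga : probability (borel E * borel E)%type R, coupling mu nu ga &
    (\int[ga]_z (lam z.1 z.2)%:E <= L%:E)%E.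
Proof.
have [ga cga gaL] := fdist_limit_coupling; exists ga => //.
have cv := @cvg_monotone_convergence _ _ _ ga setT measurableT
  (fun n z => (fdist n z.1 z.2)%:E) _ _ _.
rewrite (eq_integral (fun z : borel E * borel E => limn (fun n => (fdist n z.1 z.2)%:E))).
  rewrite -(cvg_lim _ (cv _ _ _))//.
  - apply: lime_le.
      apply/cvg_ex; eexists; apply: cv.
      + by move=> n; apply/measurable_EFinP.
      + by move=> n z _; rewrite lee_fin fdist_ge0.
      + by move=> z _ m n mn; rewrite lee_fin fdist_homo.
    apply: nearW => n; have := gaL n; rewrite -lee_fin /Rintegral fineK//.
    by apply: integrable_fin_num => //; exact: fdist_integrable.
  - by move=> n; apply/measurable_EFinP.
  - by move=> n z _; rewrite lee_fin fdist_ge0.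
  - by move=> z _ m n mn; rewrite lee_fin fdist_homo.
by move=> z _; apply/esym/cvg_lim => //; exact: fdist_cvg_lambda.
Qed.

End enumerated.
End lambda_coupling.

(** * Kernels and the semigroup *)

Section C0_norm.
Context {R : realType} {E : ptopologicalType}.

Lemma C0_bounded (f : C0 R E) : exists M, forall x, `|f x| <= M.
Proof.
have /asboolP[cf vf] := C0_funP f.
have [K cK fK] := vf 1 ltr01.
have /compact_bounded[M [_ MK]] : compact (f @` K).
  by apply: continuous_compact => //; exact: continuous_subspaceT.
exists (Num.max 1 (M + 1)) => x; rewrite le_max.
have [Kx|Kx] := pselect (K x); last by rewrite ltW// fK.
by rewrite [X in _ || X](MK (M + 1)) ?orbT ?ltrDl//; exists x.
Qed.

Lemma C0_norm_ub (f : C0 R E) x : `|f x| <= C0_norm f.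
Proof.
apply: ub_le_sup; last by exists x.
by have [M fM] := C0_bounded f; exists M => _ [y _ <-].
Qed.

End C0_norm.

Section CTMP_theory.
Context {R : realType} {E : ptopologicalType} (X : CTMP R E).
Hypotheses (E_locally_compact : locally_compact [set: E])
  (E_hausdorff : hausdorff_space E)
  (E_second_countable : @second_countable E)
  (E_polish : polish_space R E).

(** Strong continuity at time 0, applied to [P_t f], since [P_s f = P_(s-t) (P_t f)]. *)
Lemma semigroup_right_continuous t (f : C0 R E) x (eps : R) : 0 < eps ->
  exists2 dl : R, 0 < dl & forall s : {nonneg R},
    t%:num <= s%:num < t%:num + dl ->
    `|\int[kernel_at X s x]_y f y - \int[kernel_at X t x]_y f y| < eps.
Proof.
move=> eps0.
have [dl dl0 H] := semigroup_strongly_continuous X (semigroup X t f) eps0.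
exists dl => // s /andP[ts sd]; rewrite -!semigroup_kernel.
have st0 : 0 <= s%:num - t%:num by rewrite subr_ge0.
have -> : semigroup X s f = semigroup X (NngNum st0) (semigroup X t f).
  by rewrite semigroup_D; congr (semigroup X _ f); apply/val_inj => /=; rewrite subrK.
apply: le_lt_trans (H (NngNum st0) _); last by rewrite /= ltrBlDl.
exact: le_trans (C0_norm_ub _ x).
Qed.

(** [f] need not vanish at infinity, so it is multiplied by a cutoff [psi] that carries almost all
    mass of [P_t x]. Right continuity for [psi] itself shows that [P_s x] loses little mass too,
    uniformly for [s] close to [t]. *)
Lemma kernel_right_continuous t x (f : E -> R) (eps : R) : 0 < eps ->
  continuous f -> (forall y, 0 <= f y <= 1) ->
  exists2 dl : R, 0 < dl & forall s : {nonneg R},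
    t%:num <= s%:num < t%:num + dl ->
    `|\int[kernel_at X s x]_y f y - \int[kernel_at X t x]_y f y| <= eps.
Proof.
move=> eps0 cf f01.
have [_ [d [d_metric d_topology _]]] := E_polish.
have e8 : 0 < eps / 8 by rewrite divr_gt0.
pose Pr s : probability (borel E) R := sval (kernel_probability X s x).
have [K [_ [cK _ _ _ [muK _]]]] := borel_regular d_metric d_topology
  E_locally_compact E_hausdorff E_second_countable (Pr t) e8 measurableT.
have [psi [cpsi psi01 psiK [L cL psiL]]] := compact_cutoff d_metric d_topology
  E_locally_compact cK.
have psiC0 : psi \in @C0_pred R E by exact: C0_of_compact_support cL psiL.
have cfpsi : continuous (fun y => f y * psi y).
  by move=> y; apply: cvgM; [exact: cf|exact: cpsi].
have fpsiC0 : (fun y => f y * psi y) \in @C0_pred R E.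
  by apply: (C0_of_compact_support cfpsi cL) => y /psiL ->; rewrite mulr0.
have [d1 d10 H1] := semigroup_right_continuous t (MkC0 psiC0) x e8.
have [d2 d20 H2] := semigroup_right_continuous t (MkC0 fpsiC0) x e8.
exists (Num.min d1 d2); first by rewrite lt_min d10.
move=> s /andP[ts sd].
have {}H1 := H1 s; have {}H2 := H2 s.
have s1 : t%:num <= s%:num < t%:num + d1.
  by rewrite ts (lt_le_trans sd)// lerD2l ge_min lexx.
have s2 : t%:num <= s%:num < t%:num + d2.
  by rewrite ts (lt_le_trans sd)// lerD2l ge_min lexx orbT.
move: (H1 s1) (H2 s2) => {H1 H2}; rewrite /= !Rintegral_kernel -/(Pr s) -/(Pr t).
have norm1 (g : E -> R) : (forall y, 0 <= g y <= 1) -> forall y, `|g y| <= 1.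
  by move=> g01 y; have /andP[? ?] := g01 y; rewrite ger0_norm.
have Int u (g : E -> R) : continuous g -> (forall y, 0 <= g y <= 1) ->
    (Pr u).-integrable setT (EFin \o g).
  move=> cg g01; apply: (@bounded_integrable _ _ _ _ _ 1); last exact: norm1.
  exact: borel_measurable_continuous.
have fpsi01 y : 0 <= f y * psi y <= 1.
  have /andP[? ?] := f01 y; have /andP[? ?] := psi01 y.
  by rewrite mulr_ge0//= mulr_ile1.
(* Since [f <= 1], the cutoff changes the integral by at most the mass that [psi] misses. *)
have split u : 0 <= \int[Pr u]_y f y - \int[Pr u]_y (f y * psi y) <=
    1 - \int[Pr u]_y psi y.
  have If := Int u _ cf f01; have Ip := Int u _ cpsi psi01.
  have Ifp := Int u _ cfpsi fpsi01.
  have I1 : (Pr u).-integrable setT (EFin \o (cst 1 : E -> R)).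
    exact: finite_measure_integrable_cst.
  have -> : 1 = \int[Pr u]_y (1 : R) by rewrite Rintegral_prob_cst.
  rewrite -!RintegralB//; apply/andP; split.
    apply: Rintegral_ge0 => y _; have /andP[? ?] := f01 y.
    have /andP[? ?] := psi01 y.
    by rewrite subr_ge0 ler_piMr.
  apply: le_Rintegral => //.
  - by apply: (integrableB _ If Ifp).
  - by apply: (integrableB _ I1 Ip).
  - move=> y _; have /andP[f0 f1] := f01 y; have /andP[p0 p1] := psi01 y.
    have -> : f y - f y * psi y = f y * (1 - psi y) by ring.
    by rewrite -[leRHS]mul1r ler_wpM2r// subr_ge0.
have psit : 1 - eps / 8 <= \int[Pr t]_y psi y.
  have mK := borel_compact E_hausdorff cK.
  have PK : 1 - eps / 8 <= fine (Pr t K).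
    have : (Pr t (~` K) < (eps / 8)%:E)%E by rewrite -setTD.
    rewrite probability_setC// -[Pr t K]fineK ?fin_num_measure//.
    by rewrite -EFinB lte_fin => ?; lra.
  apply: (le_trans PK).
  have -> : fine (Pr t K) = \int[Pr t]_y \1_K y.
    by rewrite /Rintegral integral_indic// setIT.
  apply: le_Rintegral => //.
  - exact: integrable_indic.
  - exact: Int.
  - move=> y _; rewrite indicE; case: (boolP (y \in K)) => yK.
      by rewrite psiK//; move: yK; rewrite inE.
    by have /andP[] := psi01 y.
have /andP[] := split s; have /andP[] := split t; move: psit.
move: (\int[Pr t]_y f y) (\int[Pr s]_y f y) (\int[Pr t]_y psi y)
  (\int[Pr s]_y psi y) (\int[Pr t]_y (f y * psi y)) (\int[Pr s]_y (f y * psi y)).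
move=> a1 a2 a3 a4 a5 a6 ? ? ? ? ?; rewrite !ltr_norml ler_norml.
by move=> /andP[? ?] /andP[? ?]; apply/andP; split; lra.
Qed.

(** A bump [f] at [x] below the indicator of [U] has [P_0 f = f], so [1 = f x] is at most the mass
    of [U]. *)
Lemma kernel0_open x U : open U -> U x -> kernel_at X 0%:nng x U = 1%E.
Proof.
move=> oU Ux; have [_ [d [d_metric d_topology _]]] := E_polish.
have mU := borel_open oU.
have [f [f01 fx fU]] := open_nbhs_bump d_metric d_topology E_locally_compact oU Ux.
have [P PE] := kernel_probability X 0%:nng x; rewrite -PE.
apply/eqP; rewrite eq_le probability_le1//=.
have f1 : 1 = \int[kernel_at X 0%:nng x]_y f y.
  rewrite -semigroup_kernel -fx.
  exact: (congr1 (fun g : C0 R E => g x) (esym (semigroup_0 X f))).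
have cf : continuous f by have /asboolP[] := C0_funP f.
have mf := borel_measurable_continuous cf.
have : \int[P]_y f y = 1.
  rewrite [RHS]f1; congr fine; apply: eq_measure_integral => S mS _.
  exact: PE.
move=> fP; rewrite -[P U]fineK ?fin_num_measure// lee_fin -[leLHS]fP.
have -> : fine (P U) = \int[P]_y \1_U y.
  by rewrite /Rintegral integral_indic// setIT.
apply: le_Rintegral => //.
- apply: (@bounded_integrable _ _ _ _ _ 1) => // y.
  by have /andP[? ?] := f01 y; rewrite ger0_norm.
- exact: integrable_indic.
- move=> y _; rewrite indicE; case: (boolP (y \in U)) => yU.
    by have /andP[] := f01 y.
  by rewrite fU//; move: yU; rewrite notin_setE.
Qed.

End CTMP_theory.

(** * The two inequalities of the fixpoint equation *)

Section fixpoint.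
Context {R : realType} {E : ptopologicalType} (X : CTMP R E) (c : R).
Hypotheses (c_gt0 : 0 < c) (c_lt1 : c < 1).
Hypotheses (E_locally_compact : locally_compact [set: E])
  (E_hausdorff : hausdorff_space E)
  (E_second_countable : @second_countable E)
  (E_polish : polish_space R E).

Local Notation ev := (interp X c).
Local Notation lam := (lambda X c).

Let ev_continuous f : continuous (ev f).
Proof. by have [] := interp_continuous_unit X c_gt0 c_lt1 E_polish f. Qed.

Let ev01 f x : 0 <= ev f x <= 1.
Proof. by have [] := interp_continuous_unit X c_gt0 c_lt1 E_polish f. Qed.

(** At rational times this is the definition of [lambda] at the formula [FDia]. A real [t] is
    approximated from the right by rationals, using right continuity of the kernels and continuity
    of the power. *)
Lemma lambda_formula_gap t f x y :
  c `^ t%:num * `|\int[kernel_at X t x]_z ev f z - \int[kernel_at X t y]_z ev f z|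
    <= lam x y.
Proof.
set a := \int[kernel_at X t x]_z ev f z; set b := \int[kernel_at X t y]_z ev f z.
apply/ler_addgt0Pr => eps eps0; move: (eps : R) eps0 => {}eps eps0.
have e4 : 0 < eps / 4 by rewrite divr_gt0.
have [d1 d10 H1] := kernel_right_continuous X E_locally_compact E_hausdorff
  E_second_countable E_polish t x e4 (@ev_continuous f) (ev01 f).
have [d2 d20 H2] := kernel_right_continuous X E_locally_compact E_hausdorff
  E_second_countable E_polish t y e4 (@ev_continuous f) (ev01 f).
have cvc : c `^ s @[s --> t%:num] --> c `^ t%:num.
  rewrite /powR gt_eqF//; apply: continuous_comp; last exact: continuous_expR.
  by apply: cvgM; [exact: cvg_id|exact: cvg_cst].
have /cvgrPdist_lt/(_ _ e4)[/= d3 d30 H3] := cvc.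
have tlt : t%:num < t%:num + Num.min (Num.min d1 d2) d3.
  by rewrite ltrDl !lt_min d10 d20.
have [q] := rat_in_itvoo tlt; rewrite in_itv/= => /andP[tq qt].
have q0 : 0 <= q by rewrite -(ler0q R) (le_trans _ (ltW tq)).
pose s := time_of_rat R (NngNum q0).
have sq : s%:num = ratr q by [].
have ltq d : Num.min (Num.min d1 d2) d3 <= d -> t%:num <= s%:num < t%:num + d.
  by move=> h; rewrite sq (ltW tq)/= (lt_le_trans qt)// lerD2l.
have := H1 s (ltq d1 _); rewrite !ge_min lexx => /(_ isT).
have := H2 s (ltq d2 _); rewrite !ge_min lexx orbT => /(_ isT).
have /(H3 (ratr q)) : `|t%:num - ratr q| < d3.
  rewrite distrC ger0_norm ?subr_ge0 ?ltW// ltrBlDl.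
  by rewrite (lt_le_trans qt)// lerD2l !ge_min lexx orbT.
have := lambda_ub X c_gt0 c_lt1 E_polish (FDia (NngNum q0) f) x y.
rewrite /= -/s -mulrBr normrM (ger0_norm (powR_ge0 _ _)).
set a' := \int[kernel_at X s x]_z ev f z; set b' := \int[kernel_at X s y]_z ev f z.
have k01 u z : 0 <= \int[kernel_at X u z]_w ev f w <= 1.
  rewrite Rintegral_kernel; apply: Rintegral_prob01; last exact: ev01.
  exact: borel_measurable_continuous.
have /andP[] := k01 t x; have /andP[] := k01 t y; rewrite -/a -/b.
have q1 : c `^ ratr q <= 1.
  by apply: powR_le1; [rewrite c_gt0 ltW|rewrite ler0q].
have := powR_ge0 c (ratr q).
move: q1; move: (c `^ ratr q) (c `^ t%:num) (lam x y) a a' b b'.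
move=> u v l a a' b b' u1 u0 b0 b1 a0 a1 ul uv bb aa.
have ab : `|a - b| <= 1 by rewrite ler_norml; apply/andP; split; lra.
have aabb : `|a - b| <= `|a' - b'| + eps / 2.
  have -> : a - b = (a' - b') - (a' - a) + (b' - b) by ring.
  apply: (le_trans (ler_normD _ _)).
  have := ler_normB (a' - b') (a' - a); lra.
(* Replacing [c ^ t] by [u + eps / 4] costs [eps / 4], as [|a - b| <= 1]; moving the integrals to
   the rational time costs [eps / 2], as [u <= 1]. *)
apply: (@le_trans _ _ ((u + eps / 4) * `|a - b|)).
  apply: ler_wpM2r => //; move: uv; rewrite ltr_norml => /andP[? ?]; lra.
rewrite mulrDl; have : eps / 4 * `|a - b| <= eps / 4.
  by rewrite ler_piMr// ltW.
have : u * `|a - b| <= u * `|a' - b'| + u * (eps / 2).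
  by rewrite -mulrDr ler_wpM2l.
have : u * (eps / 2) <= eps / 2 by rewrite ler_piMl// divr_ge0// ltW.
lra.
Qed.

Lemma Fc_lambda_le x y : (Fc X c lam x y <= (lam x y)%:E)%E.
Proof.
apply: ge_ereal_sup => _ [t _ <-].
have ct : 0 < c `^ t%:num by exact: powR_gt0.
have [e e_surj] := formula_enumeration.
have [mu muE] := kernel_probability X t x.
have [nu nuE] := kernel_probability X t y.
pose L := lam x y / c `^ t%:num.
have gap f : \int[mu]_z ev f z - \int[nu]_z ev f z <= L.
  have muI : \int[mu]_z ev f z = \int[kernel_at X t x]_z ev f z.
    by congr fine; apply: eq_measure_integral => S mS _; exact: muE.
  have nuI : \int[nu]_z ev f z = \int[kernel_at X t y]_z ev f z.
    by congr fine; apply: eq_measure_integral => S mS _; exact: nuE.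
  rewrite muI nuI /L ler_pdivlMr// mulrC (le_trans _ (lambda_formula_gap t f x y))//.
  by rewrite ler_wpM2l ?powR_ge0// ler_norm.
have [ga cga gaL] := lambda_limit_coupling c_gt0 c_lt1 E_locally_compact
  E_hausdorff E_second_countable E_polish e_surj gap.
have cga' : coupling (kernel_at X t x) (kernel_at X t y) ga.
  move=> A mA; have [gaA gaA'] := cga A mA.
  by split; [exact: etrans gaA (muE A)|exact: etrans gaA' (nuE A)].
have WL : (W lam (kernel_at X t x) (kernel_at X t y) <= L%:E)%E.
  by apply: ereal_inf_le; exists (\int[ga]_z (lam z.1 z.2)%:E)%E => //; exists ga.
apply: (@le_trans _ _ ((c `^ t%:num)%:E * L%:E)%E).
  by rewrite lee_pmul2l// lte_fin.
by rewrite -EFinM /L mulrC divfK// gt_eqF.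
Qed.

Lemma Fc_lambda_ge x y : ((lam x y)%:E <= Fc X c lam x y)%E.
Proof.
have [e e_surj] := formula_enumeration.
apply: (@le_trans _ _ (W lam (kernel_at X 0%:nng x) (kernel_at X 0%:nng y))); last first.
  apply: ereal_sup_ubound; exists 0%:nng => //.
  by rewrite /= powRr0 mul1e.
apply: le_ereal_inf_tmp => _ [ga cga <-].
have I0 : (0 <= \int[ga]_z (lam z.1 z.2)%:E)%E.
  by apply: integral_ge0 => z _; rewrite lee_fin lambda_ge0.
apply/lee_addgt0Pr => eps eps0.
have [f lf] : exists f, lam x y - eps / 2 < `|ev f x - ev f y|.
  apply: contrapT => /forallNP H.
  have : lam x y <= lam x y - eps / 2.
    by apply: lambda_lub => // f; rewrite leNgt; apply/negP.
  by have := eps0 : 0 < (eps : R); lra.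
have e4 : 0 < eps / 4 :> R by rewrite divr_gt0.
(* On [U x * U y] the gap of [f] falls by less than [eps / 2]. As [f] is within [eps / 2] of
   attaining [lambda], the bound [lam x y - eps] holds there. *)
pose U p := [set z | `|ev f p - ev f z| < eps / 4].
have oU p : open (U p).
  apply: (@open_comp _ _ (fun z => `|ev f p - ev f z|) [set r | r < eps / 4]).
    move=> z _; apply: cvg_norm; apply: cvgB; first exact: cvg_cst.
    exact: ev_continuous.
  exact: open_lt.
have Up p : U p p by rewrite /U/= subrr normr0.
have mU p : measurable (U p : set (borel E)) := borel_open (oU p).
(* Each marginal gives full mass to its open neighbourhood, so the complement of the rectangle is a
   union of two null strips. *)
have gaU : ga (U x `*` U y) = 1%E.
  have mX : measurable (U x `*` setT : set (borel E * borel E)%type).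
    exact: measurableX.
  have mY : measurable (setT `*` U y : set (borel E * borel E)%type).
    exact: measurableX.
  have gaX : ga (U x `*` setT) = 1%E.
    by have [-> _] := cga _ (mU x); exact: kernel0_open.
  have gaY : ga (setT `*` U y) = 1%E.
    by have [_ ->] := cga _ (mU y); exact: kernel0_open.
  have mUU : measurable (U x `*` U y : set (borel E * borel E)%type).
    exact: measurableX.
  have gaXC : ga (~` (U x `*` setT)) = 0%E.
    by have := probability_setC ga mX; rewrite gaX subee.
  have gaYC : ga (~` (setT `*` U y)) = 0%E.
    by have := probability_setC ga mY; rewrite gaY subee.
  have gaC : (ga (~` (U x `*` U y)) <= 0)%E.
    apply: (@le_trans _ _ (ga (~` (U x `*` setT) `|` ~` (setT `*` U y)))).
      apply: le_measure; rewrite ?inE.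
      - exact: measurableC.
      - by apply: measurableU; exact: measurableC.
      - move=> [u v] /= nuv.
        apply: contrapT => /not_orP[/contrapT[Uu _] /contrapT[_ Uv]].
        exact: nuv.
    apply: (le_trans (measureU2 _ _ _)); [exact: measurableC|exact: measurableC|].
    by rewrite /= gaXC gaYC adde0.
  apply/eqP; rewrite eq_le probability_le1//=.
  by move: gaC; rewrite probability_setC// leeBlDr ?add0e// fin_num_measure.
set a := lam x y - eps.
have aU z : (U x `*` U y) z -> a <= lam z.1 z.2.
  move=> [/= zx zy]; apply: le_trans (lambda_ub X c_gt0 c_lt1 E_polish f z.1 z.2).
  move: zx zy lf; rewrite /U /= /a => zx zy lf.
  have := ler_normD (ev f x - ev f z.1 + (ev f z.1 - ev f z.2)) (ev f z.2 - ev f y).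
  have := ler_normD (ev f x - ev f z.1) (ev f z.1 - ev f z.2).
  rewrite !addrA !subrK (distrC (ev f z.2)).
  by have := eps0 : 0 < (eps : R); lra.
suff : (a%:E <= \int[ga]_z (lam z.1 z.2)%:E)%E.
  by rewrite /a EFinB leeBlDr.
(* For [a <= 0] nonnegativity of the integral suffices; for [a > 0] the constant is a nonnegative
   integrand below [lam] on the rectangle. *)
have [a0|a0] := leP a 0; first by rewrite (le_trans _ I0)// lee_fin.
apply: (@le_trans _ _ (\int[ga]_(z in U x `*` U y) a%:E)%E).
  by rewrite integral_cst ?[X in (_ * X)%E]gaU ?mule1//; exact: measurableX.
apply: (@le_trans _ _ (\int[ga]_(z in U x `*` U y) (lam z.1 z.2)%:E)%E).
  apply: ge0_le_integral => //.
  - exact: measurableX.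
  - by move=> z _; rewrite lee_fin ltW.
  - by apply: measurable_funTS; exact: lambda_measurable.
apply: ge0_subset_integral => //.
- exact: measurableX.
- exact: lambda_measurable.
- by move=> z _; rewrite lee_fin lambda_ge0.
Qed.

End fixpoint.

Theorem theorem3 (R : realType) (E : ptopologicalType)
    (E_locally_compact : locally_compact [set: E])
    (E_hausdorff : hausdorff_space E)
    (E_second_countable : @second_countable E)
    (E_polish : polish_space R E)
    (X : CTMP R E) (c : R) (c_gt0 : 0 < c) (c_lt1 : c < 1) :
  (pseudometric1 (lambda X c) /\ lsc (lambda X c)) /\
  (forall x y : E, Fc X c (lambda X c) x y = (lambda X c x y)%:E).
Proof.
split; first by split; [exact: lambda_pseudometric1|exact: lambda_lsc].
move=> x y; apply/eqP; rewrite eq_le.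
by rewrite Fc_lambda_le// Fc_lambda_ge.
Qed.
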